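(* Let $\mu$ be doubling. Let $X$ be a quasi-Banach function space over $\mathcal P$ with absolutely continuous quasinorm. Suppose that for every $0<\gamma<1$ and for every ball $B\subset\mathcal P$ there exists a constant $C$ such that $$\|(\mathcal M^\gamma_1 g)\chi_B\|_X\le C\|g\|_X\quad\text{for every } g\in X.$$ Let $0<s\le 1$. Then, for every quasicontinuous $u\in\dot M^{s,X}(\mathcal P)$, there exists a set $E\subset\mathcal P$ with $C_{M^{s,X}}(E)=0$ such that $$\lim_{r\to 0} m^\gamma_{|u-u(x)|}(B(x,r))=0\quad\text{and}\quad \lim_{r\to 0} m^\gamma_{u}(B(x,r))=u(x)$$ for every $x\in\mathcal P\setminus E$ and every $0<\gamma<1$.
   Context: Space. $\mathcal P=(\mathcal P,d,\mu)$ is a metric space $(\mathcal P,d)$ with a Borel regular outer measure $\mu$ such that every ball $B(x,r)=\{y\in\mathcal P: d(y,x)<r\}$ ($r>0$) has positive and finite measure, and $\mu$ is doubling: there is a constant $c_d>0$ with $\mu(B(x,2r))\le c_d\,\mu(B(x,r))$ for all $x\in\mathcal P$, $r>0$. $L^0=L^0(\mathcal P)$ is the set of measurable, almost everywhere finite functions $u:\mathcal P\to[-\infty,\infty]$. $\chi_E$ is the characteristic function of $E$. Quasi-Banach function spaces. A quasinorm on a subspace of $L^0$ is a functional $\|\cdot\|$ with: $\|f\|=0$ iff $f=0$ a.e.; $\|\alpha f\|=|\alpha|\|f\|$ for $\alpha\in\mathbb R$; $\|f+g\|\le c_\Delta(\|f\|+\|g\|)$ for some constant $c_\Delta$. A quasi-Banach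 function space $X$ over $\mathcal P$ is a subspace of $L^0(\mathcal P)$ with a complete quasinorm $\|\cdot\|_X$ such that: if $g\in X$ and $|f|\le|g|$ a.e. then $f\in X$ and $\|f\|_X\le\|g\|_X$; if $\mu(E)<\infty$ then $\|\chi_E\|_X<\infty$; if $0\le f_k\uparrow f$ a.e. then $\|f_k\|_X\uparrow\|f\|_X$ (with $\|f\|_X=\infty$ for $f\notin X$). The quasinorm is absolutely continuous if $\|f\chi_{E_k}\|_X\to0$ whenever $f\in X$ and $(E_k)$ is a decreasing sequence of sets with $\bigcap_k E_k=\emptyset$. Hajłasz spaces. A measurable $g:\mathcal P\to[0,\infty]$ is an $s$-gradient of $u\in L^0$ if there is $E\subset\mathcal P$ with $\mu(E)=0$ such that $|u(x)-u(y)|\le d(x,y)^s(g(x)+g(y))$ for all $x,y\in\mathcal P\setminus E$. $\mathcal D^s(u)$ is the set of all $s$-gradients of $u$. $\dot M^{s,X}$ consists of measurable $u$ with $\|u\|_{\dot M^{s,X}}=\inf_{g\in\mathcal D^s(u)}\|g\|_X<\infty$; $M^{s,X}=\dot M^{s,X}\cap X$ with $\|u\|_{M^{s,X}}=\|u\|_X+\|u\|_{\dot M^{s,X}}$. Capacity. $C_{M^{s,X}}(E)=\inf\{\|u\|_{M^{s,X}}: u\in M^{s,X},\ u\ge1 \text{ on a neighbourhood of } E\}$. A function $u:\mathcal P\to[-\infty,\infty]$ is quasicontinuous if for every $\varepsilon>0$ there is $E\subset\mathcal P$ with $C_{M^{s,X}}(E)<\varepsilon$ such that the restriction of $u$ to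 $\mathcal P\setminus E$ is continuous. Medians. For $0<\gamma<1$, measurable $u$ and a set $A$ of finite measure, $m_u^\gamma(A)=\inf\{a\in\mathbb R:\mu(\{x\in A:u(x)>a\})<\gamma\mu(A)\}$. For $0<R\le\infty$, $\mathcal M^\gamma_R u(x)=\sup_{0<r<R}m^\gamma_{|u|}(B(x,r))$. *)

(* Defs.v *)
From HB Require Import structures.
From mathcomp Require Import all_boot all_order all_algebra.
From mathcomp Require Import all_classical all_reals all_analysis.
From mathcomp Require Import measurable_realfun.

Set Implicit Arguments.
Unset Strict Implicit.
Unset Printing Implicit Defensive.

Import Order.TTheory GRing.Theory Num.Def Num.Theory.
Import numFieldNormedType.Exports.

Local Open Scope classical_set_scope.
Local Open Scope ring_scope.
Local Open Scope ereal_scope.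

(* Nonempty metric spaces. The base point plays no mathematical role: the
   sigma-algebra that an outer measure induces is only available over pointed
   types. *)
#[short(type="pmetricType")]
HB.structure Definition PointedMetric (K : numDomainType) :=
  { M of Metric K M & isPointed M }.

Section measure_space.
Context (R : realType) (P : pmetricType R) (mu : {outer_measure set P -> \bar R}).

Definition borel_regular :=
  (forall B : set P, <<s @open P >> B -> mu.-caratheodory B) /\
  (forall A : set P, exists B : set P,
     [/\ <<s @open P >> B, A `<=` B & mu B = mu A]).

Definition balls_pos_finite :=
  forall (x : P) (r : R), (0 < r)%R -> 0 < mu (ball x r) < +oo.

Definition doubling := exists2 c : R, (0 < c)%R &
  forall (x : P) (r : R), (0 < r)%R ->
    mu (ball x (2 * r)%R) <= c%:E * mu (ball x r).

(* The measure space (P, mu): all Caratheodory measurable sets are measurable,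
   and "almost everywhere" refers to the sets of outer measure zero. *)
Definition cara_measure : {measure set (caratheodory_type mu) -> \bar R} :=
  (mu : set (caratheodory_type mu) -> \bar R).

Definition cara_measurable_fun (u : P -> \bar R) :=
  measurable_fun [set: caratheodory_type mu] (u : caratheodory_type mu -> \bar R).

Definition L0 : set (P -> \bar R) :=
  [set u | cara_measurable_fun u /\ \forall x \ae cara_measure, u x \is a fin_num].

(* Sums of extended real functions use the library convention
   +oo + -oo = -oo; for members of L0 this only matters on a null set. *)
Definition subspace_L0 (V : set (P -> \bar R)) :=
  [/\ V `<=` L0,
      V (cst 0),
      (forall (a : R) f, V f -> V (fun x => a%:E * f x)) &
      (forall f g, V f -> V g -> V (fun x => f x + g x))].

Definition quasinorm (V : set (P -> \bar R)) (N : (P -> \bar R) -> \bar R) :=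
  [/\ (forall f, V f -> 0 <= N f < +oo),
      (forall f, V f -> (N f = 0 <-> \forall x \ae cara_measure, f x = 0)),
      (forall (a : R) f, V f -> N (fun x => a%:E * f x) = `|a|%:E * N f) &
      (exists c : R, forall f g, V f -> V g ->
         N (fun x => f x + g x) <= c%:E * (N f + N g))].

Definition quasinorm_complete
    (V : set (P -> \bar R)) (N : (P -> \bar R) -> \bar R) :=
  forall f : nat -> P -> \bar R, (forall n, V (f n)) ->
    (forall e : R, (0 < e)%R -> exists n0, forall m n,
       (n0 <= m)%N -> (n0 <= n)%N -> N (fun x => f m x - f n x) < e%:E) ->
    exists2 g, V g & N (fun x => f n x - g x) @[n --> \oo] --> 0.

Record qbfs := QBFS {
  qcarrier : set (P -> \bar R) ;
  qnorm : (P -> \bar R) -> \bar R ;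
  qbfs_subspace : subspace_L0 qcarrier ;
  qnorm_quasinorm : quasinorm qcarrier qnorm ;
  qnorm_complete : quasinorm_complete qcarrier qnorm ;
  qnorm_pinfty : forall f, ~ qcarrier f -> qnorm f = +oo ;
  qbfs_lattice : forall f g, cara_measurable_fun f -> qcarrier g ->
    (\forall x \ae cara_measure, `|f x| <= `|g x|) ->
    qcarrier f /\ qnorm f <= qnorm g ;
  qnorm_indic : forall E : set P, mu.-caratheodory E -> mu E < +oo ->
    qnorm (fun x => (\1_E x)%:E) < +oo ;
  qnorm_fatou : forall (f_ : nat -> P -> \bar R) (f : P -> \bar R),
    (forall k, cara_measurable_fun (f_ k)) -> cara_measurable_fun f ->
    (\forall x \ae cara_measure,
       [/\ forall k, 0 <= f_ k x,
           forall k, f_ k x <= f_ k.+1 x &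
           f_ k x @[k --> \oo] --> f x]) ->
    (forall k, qnorm (f_ k) <= qnorm (f_ k.+1)) /\
    qnorm (f_ k) @[k --> \oo] --> qnorm f }.

Definition abs_continuous (X : qbfs) :=
  forall (f : P -> \bar R) (E : nat -> set P), qcarrier X f ->
    (forall k, mu.-caratheodory (E k)) ->
    (forall k, E k.+1 `<=` E k) -> \bigcap_k E k = set0 ->
    qnorm X (fun x => f x * (\1_(E k) x)%:E) @[k --> \oo] --> 0.

Section hajlasz.
Variables (s : R) (X : qbfs).

Definition sgradients (u : P -> \bar R) : set (P -> \bar R) :=
  [set g | [/\ cara_measurable_fun g, (forall x, 0 <= g x) &
    exists2 E : set P, mu E = 0 & forall x y, ~ E x -> ~ E y ->
      `|u x - u y| <= (mdist x y `^ s)%:E * (g x + g y)]].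

Definition dotMnorm (u : P -> \bar R) : \bar R :=
  ereal_inf (qnorm X @` sgradients u).

Definition dotM : set (P -> \bar R) := [set u | L0 u /\ dotMnorm u < +oo].

Definition MsX : set (P -> \bar R) := dotM `&` qcarrier X.

Definition Mnorm (u : P -> \bar R) : \bar R := qnorm X u + dotMnorm u.

Definition capacity (E : set P) : \bar R :=
  ereal_inf (Mnorm @` [set u | MsX u /\
    exists U : set P, [/\ open U, E `<=` U & forall x, U x -> 1 <= u x]]).

Definition quasicontinuous (u : P -> \bar R) :=
  forall e : R, (0 < e)%R ->
    exists2 E : set P, capacity E < e%:E & {within ~` E, continuous u}.

End hajlasz.

Definition median (gamma : R) (u : P -> \bar R) (A : set P) : \bar R :=
  ereal_inf [set a%:E | a in
    [set a : R | mu (A `&` [set x | a%:E < u x]) < gamma%:E * mu A]].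

Definition median_maximal (gamma : R) (rho : \bar R) (u : P -> \bar R) (x : P) :=
  ereal_sup [set median gamma (fun y => `|u y|) (ball x r) | r in
    [set r : R | (0 < r)%R /\ r%:E < rho]].

End measure_space.

(* Main.v *)
Require Import Defs.
From mathcomp Require Import all_boot all_order all_algebra.
From mathcomp Require Import all_classical all_reals all_analysis.
From mathcomp Require Import measurable_realfun.
From mathcomp Require Import ring lra.

Set Implicit Arguments.
Unset Strict Implicit.
Unset Printing Implicit Defensive.

Import Order.TTheory GRing.Theory Num.Def Num.Theory.
Import numFieldNormedType.Exports.

Local Open Scope classical_set_scope.
Local Open Scope ring_scope.
Local Open Scope ereal_scope.

(** Suppose that [u x] is finite and that [u] is continuous at [x] relative to
    the complement of a set [U] which occupies less than the proportion
    [min(gamma, 1 - gamma)] of every small ball around [x]. Then [u] is close to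
    [u x] on all but a small proportion of these balls, so both medians converge
    as claimed ([median_limits]). Quasicontinuity provides sets [U] of arbitrarily
    small capacity relative to whose complement [u] is continuous, and it remains
    to see that few points [x] are bad for [U].

    This is the content of [small_capacity_density]: if [phi] is a test function
    of small norm, then the points of a fixed ball around which some ball of
    radius less than 1/8 is filled by [phi >= 1] in proportion at least [gamma]
    form a set of small capacity. For a test function [phi] of the set [U] it
    bounds the capacity of the bad points, so that the points where approximate
    continuity fails have capacity zero ([not_approx_continuous_small]). For
    truncations of [e |u|], cut off outside a ball, it shows that the points of
    approximate continuity with an infinite value of [u] have capacity zero as
    well: such a value forces [e |u| >= 1] on most of every small ball, while the
    norm tends to 0 with [e] ([approx_infinite_small]).

    The estimate needs a test function that is at least 1 near all these points,
    with a gradient controlled by the median maximal function of the gradient [g]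
    of [phi]. The supremum of the medians of [phi] over balls around [x] is not
    suitable: replacing the centre [x] by [y] costs the oscillation of [phi] on
    the scale [r] of the ball, hence [r ^ s] instead of [mdist x y ^ s]. The
    function [regularized] repairs this. A ball [B(z, r)] on which [phi >= t]
    in proportion [gamma] contributes the value [t - 10 a mdist x z ^ s] at all
    points [x] with [mdist x z < 2 r], where [a] bounds [g] on most of
    [B(z, 4 r)]. The slope [a] can be chosen below any bound for the median
    maximal function of [g] at [x]. When [x] leaves the reach of the ball, the
    contribution has decreased by the oscillation of [phi] on the scale [r], and
    is therefore available from the ball of radius [r] around [x] itself
    ([level_transfer]). Hence the maximum of [phi] and [regularized] has the
    desired gradient ([regularized_gradient]). The superlevel sets of
    [regularized] are open ([regularized_superlevel_open]), as the capacity
    demands, and [regularized] is at most a median maximal function of [phi]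
    ([regularized_le_maximal]). A Lipschitz cutoff ([cutoff_pair]) makes the
    boundedness of the median maximal operator on balls applicable. *)

(** * Quasinorm estimates *)

Section function_space.
Context (R : realType) (P : pmetricType R) (mu : {outer_measure set P -> \bar R}).
Context (X : qbfs mu).

Lemma qnorm_ge0 (f : P -> \bar R) : 0 <= qnorm X f.
Proof.
have [Xf|/qnorm_pinfty ->] := pselect (qcarrier X f); last exact: leey.
by have [+ _ _ _] := qnorm_quasinorm X => /(_ f Xf) /andP[].
Qed.

Lemma qnorm_carrier (f : P -> \bar R) : qnorm X f < +oo -> qcarrier X f.
Proof. by move=> Nf; apply: contrapT => /qnorm_pinfty Xf; rewrite Xf ltxx in Nf. Qed.

Lemma le_qnorm (f g : P -> \bar R) : cara_measurable_fun mu f ->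
  (forall x, `|f x| <= `|g x|) -> qnorm X f <= qnorm X g.
Proof.
move=> mf fg; have [Xg|/qnorm_pinfty ->] := pselect (qcarrier X g); last exact: leey.
by have [] := qbfs_lattice mf Xg (aeW (cara_measure mu) fg).
Qed.

Lemma qnormD : exists2 c : R, (1 <= c)%R & forall f g : P -> \bar R,
  qnorm X (fun x => f x + g x) <= c%:E * (qnorm X f + qnorm X g).
Proof.
have [_ _ _ [c cP]] := qnorm_quasinorm X.
exists (Num.max c 1%R) => [|f g]; first by rewrite le_max lexx orbT.
have c0 : (0 < Num.max c 1)%R by rewrite lt_max ltr01 orbT.
have [Xf|/qnorm_pinfty ->] := pselect (qcarrier X f); last first.
  by rewrite addye ?gt0_muley ?leey// -ltNye (lt_le_trans _ (qnorm_ge0 _)).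
have [Xg|/qnorm_pinfty ->] := pselect (qcarrier X g); last first.
  by rewrite addey ?gt0_muley ?leey// -ltNye (lt_le_trans _ (qnorm_ge0 _)).
apply: le_trans (cP f g Xf Xg) _; apply: lee_wpmul2r.
  by rewrite adde_ge0// qnorm_ge0.
by rewrite lee_fin le_max lexx.
Qed.

Lemma qnormZ (a : R) (f : P -> \bar R) : (0 < a)%R ->
  qnorm X (fun x => a%:E * f x) <= a%:E * qnorm X f.
Proof.
move=> a0; have [Xf|/qnorm_pinfty ->] := pselect (qcarrier X f); last first.
  by rewrite gt0_muley ?leey// lte_fin.
by have [_ _ /(_ a f Xf) -> _] := qnorm_quasinorm X; rewrite gtr0_norm.
Qed.

(** Nesting the sum to the right, the quasi-triangle inequality costs a factor
    [c] per term, which a geometric decay of the norms absorbs. *)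
Lemma qnorm_sum (c : R) (f : nat -> P -> \bar R) (d : R) (n : nat) :
  (1 <= c)%R ->
  (forall f g : P -> \bar R,
    qnorm X (fun x => f x + g x) <= c%:E * (qnorm X f + qnorm X g)) ->
  (0 < d)%R ->
  (forall k, qnorm X (f k) <= (d / (2 * c) ^+ k.+1)%:E) ->
  qnorm X (fun x => \sum_(0 <= k < n) f k x) <= d%:E.
Proof.
move=> c1 cP; elim: n f d => [|n IHn] f d d0 fd.
  have X0 : qcarrier X (cst 0) by have [] := qbfs_subspace X.
  rewrite (_ : (fun _ => _) = cst 0); last by apply/funext => x; rewrite big_geq.
  have [_ /(_ _ X0)[_ N0] _ _] := qnorm_quasinorm X.
  by rewrite N0 ?lee_fin ?ltW//; apply: (aeW (cara_measure mu)).
have c0 : (0 < c)%R by apply: lt_le_trans c1.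
have c20 : (0 < 2 * c)%R by rewrite mulr_gt0.
rewrite (_ : (fun _ => _) = fun x => f 0%N x + \sum_(0 <= k < n) f k.+1 x); last first.
  by apply/funext => x; rewrite big_nat_recl.
apply: le_trans (cP _ _) _.
rewrite -[leRHS](_ : c%:E * ((d / (2 * c))%:E + (d / (2 * c))%:E) = _); last first.
  rewrite -EFinD -EFinM; congr EFin; field; exact: lt0r_neq0.
apply: lee_wpmul2l; first by rewrite lee_fin ltW.
apply: leeD; first by have := fd 0%N; rewrite expr1.
apply: IHn => [|k]; first by rewrite divr_gt0.
apply: le_trans (fd k.+1) _; rewrite lee_fin exprS invfM mulrA.
exact: lexx.
Qed.

(** The geometric decay survives the passage to infinitely many terms because
    the quasinorm has the Fatou property. *)
Lemma qnorm_nneseries : exists2 c : R, (0 < c)%R &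
  forall (f : nat -> P -> \bar R) (d : R),
  (forall k, cara_measurable_fun mu (f k)) -> (forall k x, 0 <= f k x) ->
  (0 < d)%R -> (forall k, qnorm X (f k) <= (d / c ^+ k.+1)%:E) ->
  qnorm X (fun x => \sum_(0 <= k <oo) f k x) <= d%:E.
Proof.
have [c c1 cP] := qnormD.
exists (2 * c)%R => [|f d mf f0 d0 fd]; first by rewrite mulr_gt0// (lt_le_trans _ c1).
pose S n x := \sum_(0 <= k < n) f k x.
have mS n : cara_measurable_fun mu (S n).
  exact: (@emeasurable_sum _ (caratheodory_type mu)).
have mlim : cara_measurable_fun mu (fun x => \sum_(0 <= k <oo) f k x).
  apply: (@ge0_emeasurable_sum _ (caratheodory_type mu) R setT f xpredT).
    by move=> k x _ _; exact: f0.
  by move=> k _; exact: mf.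
have [|_ Slim] := @qnorm_fatou _ _ _ X S _ mS mlim.
  apply: (@aeW _ (caratheodory_type mu)) => x; split=> [k|k|].
  - by rewrite sume_ge0.
  - by rewrite /S big_nat_recr//= leeDl.
  - by apply: is_cvg_nneseries => n _ _; exact: f0.
have cS : cvgn (qnorm X \o S) by apply/cvg_ex; eexists; exact: Slim.
rewrite -(cvg_lim (@ereal_hausdorff R) Slim); apply: (lime_le cS).
by apply: nearW => n; exact: (@qnorm_sum c f d n c1 cP d0 fd).
Qed.

End function_space.

(** * Test functions and sets of small capacity *)

Section measurability.
Context (R : realType) (P : pmetricType R) (mu : {outer_measure set P -> \bar R}).

Lemma cara_measurable_funP (f : P -> R) :
  (forall c : R, mu.-caratheodory [set x | (c < f x)%R]) ->
  cara_measurable_fun mu (fun x => (f x)%:E).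
Proof.
move=> mf; apply/measurable_EFinP.
apply: (measurability (@RGenOInfty.G R) (@RGenOInfty.measurableE R)).
move=> _ [_ [c ->] <-]; rewrite setTI.
rewrite (_ : _ @^-1` _ = [set x | (c < f x)%R]); first exact: mf.
by apply/seteqP; split => x /=; rewrite in_itv/= andbT.
Qed.

Lemma cara_measurable_gt (f : P -> \bar R) (c : \bar R) :
  cara_measurable_fun mu f -> mu.-caratheodory [set x | c < f x].
Proof.
move=> mf; have := @emeasurable_fun_o_infty _ (caratheodory_type mu) R setT f
  measurableT mf c.
by rewrite setTI.
Qed.

End measurability.

Lemma truncation_lipschitz (R : realType) (a b h : R) : (0 <= h -> a - b <= h ->
  Num.min 1 (Num.max 0 a) <= Num.min 1 (Num.max 0 b) + h)%R.
Proof.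
by move=> h0 abh; rewrite /Num.min /Num.max; do 4 (case: ifPn; rewrite -?leNgt); lra.
Qed.

Section clamp.
Context (R : realType).

Definition clamp (y : \bar R) : R := fine (mine 1%:E (maxe 0%:E y)).

Lemma clampE (y : \bar R) : (clamp y)%:E = mine 1%:E (maxe 0%:E y).
Proof.
apply: fineK; rewrite ge0_fin_numE; last by rewrite le_min le_max lexx lee01.
by rewrite gt_min ltry.
Qed.

Lemma clamp01 (y : \bar R) : (0 <= clamp y <= 1)%R.
Proof. by rewrite -!lee_fin clampE le_min lee01 le_max lexx/= ge_min lexx. Qed.

Lemma clamp_ge1 (y : \bar R) : 1 <= y -> (1 <= clamp y)%R.
Proof. by move=> y1; rewrite -lee_fin clampE le_min lexx le_max y1 orbT. Qed.

Lemma clamp_le (y : \bar R) : (clamp y)%:E <= `|y|.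
Proof.
rewrite clampE; case: y => [a| |]; rewrite ?leey//.
by rewrite -EFin_max -EFin_min/= lee_fin ge_min ge_max normr_ge0 ler_norm orbT.
Qed.

Lemma clamp_lipschitz (y z h : \bar R) : `|y - z| <= h ->
  (clamp y)%:E <= (clamp z)%:E + h.
Proof.
case: h => [h| |] yzh; last 2 first.
- by rewrite addey// leey.
- by have := le_trans (abse_ge0 _) yzh.
rewrite !clampE; case: y z yzh => [a| |] [b| |]//=.
rewrite -!EFin_max -!EFin_min -EFinD !lee_fin => abh.
have h0 : (0 <= h)%R by apply: le_trans abh.
by apply: truncation_lipschitz => //; apply: le_trans abh; exact: ler_norm.
Qed.

Lemma measurable_clamp d (T : measurableType d) (f : T -> \bar R) :
  measurable_fun setT f -> measurable_fun setT (fun x => (clamp (f x))%:E).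
Proof.
move=> mf; under eq_fun do rewrite clampE.
by apply: measurable_mine => //; exact: measurable_maxe.
Qed.

End clamp.

Definition gradient_off (R : realType) (P : pmetricType R) (s : R)
    (phi : P -> R) (g : P -> \bar R) (E : set P) :=
  forall x y, ~ E x -> ~ E y ->
    (phi x)%:E <= (phi y)%:E + (mdist x y `^ s)%:E * (g x + g y).

Section capacity.
Context (R : realType) (P : pmetricType R) (mu : {outer_measure set P -> \bar R}).
Context (s : R) (X : qbfs mu).

(** The first argument is real valued and bounded by 1 because truncated test
    functions define the same capacity; this keeps infinite values out of all
    later differences. *)
Definition test_pair (phi : P -> R) (g : P -> \bar R) :=
  [/\ cara_measurable_fun mu (fun x => (phi x)%:E),
      forall x, (0 <= phi x <= 1)%R,
      cara_measurable_fun mu g, forall x, 0 <= g x &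
      exists2 E : set P, mu E = 0 & gradient_off s phi g E].

(** Keeps the function and its gradient at hand: a capacity less than [d] implies
    this property, which implies a capacity of at most [2 d]. *)
Definition small_capacity (E : set P) (d : R) :=
  exists (phi : P -> R) (g : P -> \bar R), [/\ test_pair phi g,
    qnorm X (fun x => (phi x)%:E) <= d%:E, qnorm X g <= d%:E &
    exists U : set P, [/\ open U, E `<=` U & forall x, U x -> (1 <= phi x)%R]].

Lemma sub_small_capacity (E F : set P) (d : R) : E `<=` F ->
  small_capacity F d -> small_capacity E d.
Proof.
move=> EF [phi [g [? ? ? [U [? FU ?]]]]]; exists phi, g; split => //.
by exists U; split => //; exact: subset_trans FU.
Qed.

Lemma dotMnorm_ge0 (u : P -> \bar R) : 0 <= dotMnorm s X u.
Proof. by apply/ereal_infP => _ [g _ <-]; exact: qnorm_ge0. Qed.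

Lemma truncation_pair (u g : P -> \bar R) : cara_measurable_fun mu u ->
  sgradients mu s u g -> test_pair (fun x => clamp (u x)) g.
Proof.
move=> mu_ [mg g0 [E E0 ugE]]; split => //.
- exact: (@measurable_clamp _ _ (caratheodory_type mu)).
- by move=> x; exact: clamp01.
- by exists E => // x y Ex Ey; apply: clamp_lipschitz; exact: ugE.
Qed.

Lemma small_capacity_of_capacity (E : set P) (d : R) :
  capacity s X E < d%:E -> small_capacity E d.
Proof.
move=> /ereal_inf_lt[_ [u [[[[mu_ _] _] Xu] [U [oU EU U1]]] <-] ud].
have [_ [g ug <-] gd] : exists2 t, (qnorm X @` sgradients mu s u) t & t < d%:E.
  apply: ereal_inf_lt; apply: le_lt_trans ud.
  by rewrite /Mnorm leeDr// qnorm_ge0.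
have ud' : qnorm X u <= d%:E.
  by apply: le_trans (ltW ud); rewrite /Mnorm leeDl// dotMnorm_ge0.
have pug := truncation_pair mu_ ug; have [mphi phi01 _ _ _] := pug.
exists (fun x => clamp (u x)), g; split => //; last 2 first.
- exact: ltW.
- by exists U; split => // x Ux; apply: clamp_ge1; exact: U1.
apply: le_trans ud'; apply: le_qnorm => // x.
by rewrite gee0_abs ?clamp_le// lee_fin; have /andP[] := phi01 x.
Qed.

Lemma sgradients_of_pair (phi : P -> R) (g : P -> \bar R) :
  test_pair phi g -> sgradients mu s (fun x => (phi x)%:E) g.
Proof.
move=> [mphi phi01 mg g0 [E E0 phig]]; split => //; exists E => // x y Ex Ey.
have := phig x y Ex Ey; have := phig y x Ey Ex.
rewrite metric_sym (addeC (g y)); set h := _%:E * _.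
have h0 : 0 <= h by rewrite mule_ge0 ?lee_fin ?powR_ge0// adde_ge0.
case: h h0 => [h| |]//= h0; last by move=> *; rewrite leey.
rewrite /= -!EFinD !lee_fin => yx xy.
by rewrite ler_norml; apply/andP; split; lra.
Qed.

Lemma capacity_of_small_capacity (E : set P) :
  (forall d : R, (0 < d)%R -> small_capacity E d) -> capacity s X E = 0.
Proof.
move=> smallE; apply/eqP; rewrite eq_le; apply/andP; split; last first.
  apply/ereal_infP => _ [u _ <-].
  by rewrite adde_ge0 ?qnorm_ge0 ?dotMnorm_ge0.
apply/lee_addgt0Pr => d d0; rewrite add0e.
have d20 : (0 < d / 2)%R by rewrite divr_gt0.
have [phi [g [pg Nphi Ng [U [oU EU U1]]]]] := smallE _ d20.
pose u x := (phi x)%:E.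
have [mphi phi01 mg g0 _] := pg.
have du : dotMnorm s X u <= (d / 2)%:E.
  apply: le_trans Ng; apply: ereal_inf_lbound.
  by exists g => //; exact: sgradients_of_pair.
apply: (@le_trans _ _ (Mnorm s X u)); last first.
  by rewrite (splitr d) EFinD; exact: leeD.
apply: ereal_inf_lbound; exists u => //; split; last by exists U.
split; last by apply: qnorm_carrier; apply: le_lt_trans Nphi (ltry _).
split; last exact: le_lt_trans du (ltry _).
by split => //; apply: (aeW (cara_measure mu)).
Qed.

(** The supremum of test functions has the sum of their gradients as a
    gradient; the norms of the sums converge by the Fatou property. *)
Lemma small_capacity_bigcup (E : nat -> set P) :
  (forall n (d : R), (0 < d)%R -> small_capacity (E n) d) ->
  forall d : R, (0 < d)%R -> small_capacity (\bigcup_n E n) d.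
Proof.
move=> smallE d d0; have [c c0 cP] := qnorm_nneseries X.
have /choice[phi] : forall n, exists phi : P -> R, exists g : P -> \bar R,
    [/\ test_pair phi g, qnorm X (fun x => (phi x)%:E) <= (d / c ^+ n.+1)%:E,
      qnorm X g <= (d / c ^+ n.+1)%:E &
    exists U : set P, [/\ open U, E n `<=` U & forall x, U x -> (1 <= phi x)%R]].
  by move=> n; apply: smallE; rewrite divr_gt0// exprn_gt0.
move=> /choice[g] /all_and4[pg Nphi Ng /choice[U /all_and3[oU EU U1]]].
have mphi n : cara_measurable_fun mu (fun x => (phi n x)%:E) by have [] := pg n.
have phi01 n : forall x, (0 <= phi n x <= 1)%R by have [] := pg n.
have mg n : cara_measurable_fun mu (g n) by have [] := pg n.
have g0 n : forall x, 0 <= g n x by have [] := pg n.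
have /choice[N N0] : forall n, exists N : set P,
    mu N = 0 /\ gradient_off s (phi n) (g n) N.
  by move=> n; have [_ _ _ _ [N ? ?]] := pg n; exists N.
pose sphi x := sup (range (phi ^~ x)).
pose G x := \sum_(0 <= k <oo) g k x.
have le_sphi k x : (phi k x <= sphi x)%R.
  apply: ub_le_sup; last by exists k.
  by exists 1%R => _ [n _ <-]; have /andP[] := phi01 n x.
have sphi_le x (M : \bar R) : (forall k, (phi k x)%:E <= M) -> (sphi x)%:E <= M.
  case: M => [M| |] leM; rewrite ?leey//; last by have := leM 0%N.
  rewrite lee_fin; apply: ge_sup; first by exists (phi 0%N x), 0%N.
  by move=> _ [n _ <-]; rewrite -lee_fin.
have term_le (f : nat -> P -> \bar R) k x : (forall n x, 0 <= f n x) ->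
    f k x <= \sum_(0 <= n <oo) f n x.
  move=> f0; apply: le_trans (nneseries_lim_ge k.+1 _); last by move=> *; exact: f0.
  by rewrite big_nat_recr//= leeDr// sume_ge0.
have sphi0 x : (0 <= sphi x)%R.
  by apply: le_trans (le_sphi 0%N x); have /andP[] := phi01 0%N x.
have msphi : cara_measurable_fun mu (fun x => (sphi x)%:E).
  apply: cara_measurable_funP => b.
  rewrite (_ : [set x | _] = \bigcup_k [set x | b%:E < (phi k x)%:E]).
    by apply: caratheodory_measurable_bigcup => k; exact: cara_measurable_gt.
  apply/seteqP; split => x /=; last first.
    by move=> [k _ /=]; rewrite lte_fin => bk; exact: lt_le_trans (le_sphi k x).
  move=> /sup_gt[]; first by exists (phi 0%N x), 0%N.
  by move=> _ [k _ <-] bk; exists k => //=; rewrite lte_fin.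
exists sphi, G; split; [split => // | | | ].
- move=> x; rewrite sphi0/= -lee_fin; apply: sphi_le => k.
  by rewrite lee_fin; have /andP[] := phi01 k x.
- apply: (@ge0_emeasurable_sum _ (caratheodory_type mu) R setT g xpredT).
    by move=> k x _ _; exact: g0.
  by move=> k _; exact: mg.
- by move=> x; apply: nneseries_ge0.
- exists (\bigcup_n N n).
    apply/eqP; rewrite eq_le outer_measure_ge0 andbT.
    apply: le_trans (outer_measure_sigma_subadditive mu N) _.
    by rewrite eseries0// => n _ _; have [] := N0 n.
  move=> x y Nx Ny; apply: sphi_le => k.
  have [_ /(_ x y)] := N0 k.
  move=> /(_ (fun h => Nx (ex_intro2 _ _ k I h)) (fun h => Ny (ex_intro2 _ _ k I h))).
  move=> /le_trans; apply; apply: leeD; first by rewrite lee_fin le_sphi.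
  by apply: lee_wpmul2l; rewrite ?lee_fin ?powR_ge0// leeD// term_le.
- apply: le_trans (cP (fun k x => (phi k x)%:E) d mphi _ d0 Nphi); last first.
    by move=> k x; rewrite lee_fin; have /andP[] := phi01 k x.
  apply: le_qnorm => // x.
  rewrite !gee0_abs ?lee_fin//; last first.
    by apply: nneseries_ge0 => k _ _; rewrite lee_fin; have /andP[] := phi01 k x.
  apply: sphi_le => k; apply: (term_le (fun k x => (phi k x)%:E)) => n y.
  by rewrite lee_fin; have /andP[] := phi01 n y.
- exact: cP.
- exists (\bigcup_n U n); split.
  + by apply: bigcup_open => n _; exact: oU.
  + by move=> x [n _ /EU Ux]; exists n.
  + by move=> x [n _ /U1] /le_trans; apply.
Qed.

End capacity.

(** * Balls, densities and medians *)

Section metric_measure.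
Context (R : realType) (P : pmetricType R) (mu : {outer_measure set P -> \bar R}).

Lemma ballP (x : P) (r : R) (y : P) : ball x r y <-> (mdist x y < r)%R.
Proof. by rewrite ballEmdist. Qed.

Lemma open_of_balls (U : set P) :
  (forall x, U x -> exists2 e : R, (0 < e)%R & ball x e `<=` U) -> open U.
Proof. by move=> Uball; rewrite openE => x /Uball[e e0 xeU]; apply/nbhs_ballP; exists e. Qed.

Lemma open_metric_ball (x : P) (r : R) : open (ball x r).
Proof.
apply: open_of_balls => y /ballP xy; exists (r - mdist x y)%R; first by rewrite subr_gt0.
move=> z /ballP yz; apply/ballP; have := metric_triangle x y z; lra.
Qed.

Lemma caratheodory_open (U : set P) : borel_regular mu -> open U ->
  mu.-caratheodory U.
Proof. by move=> [borel _] oU; apply: borel; apply: sub_sigma_algebra. Qed.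

Lemma caratheodory_null (E : set P) : mu E = 0 -> mu.-caratheodory E.
Proof.
move=> E0; apply: le_caratheodory_measurable => A.
rewrite (_ : mu (A `&` E) = 0) ?add0e; first exact: le_outer_measure.
apply/eqP; rewrite eq_le outer_measure_ge0 andbT -[leRHS]E0.
exact: le_outer_measure.
Qed.

Lemma caratheodory_ball (x : P) (r : R) : borel_regular mu ->
  mu.-caratheodory (ball x r).
Proof. by move=> mub; apply: caratheodory_open => //; exact: open_metric_ball. Qed.

(** Three doublings give the factor 8, which leaves enough room for all later
    comparisons of balls of similar radii with nearby centres. *)
Lemma doubling_balls : doubling mu -> exists2 L : R, (1 <= L)%R &
  forall (x z : P) (r' r : R), (0 < r)%R -> (mdist z x + r' <= 8 * r)%R ->
    mu (ball x r') <= L%:E * mu (ball z r).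
Proof.
move=> [c c0 cP]; pose D := Num.max c 1%R.
have D1 : (1 <= D)%R by rewrite le_max lexx orbT.
have D0 : (0 < D)%R by apply: lt_le_trans D1.
have DP (x : P) (r : R) : (0 < r)%R -> mu (ball x (2 * r)) <= D%:E * mu (ball x r).
  move=> r0; apply: le_trans (cP x r r0) _.
  by apply: lee_wpmul2r; rewrite ?outer_measure_ge0 ?lee_fin ?le_max ?lexx.
exists (D * (D * D))%R => [|x z r' r r0 xz].
  by rewrite -[leLHS]mulr1 ler_pM// -[leLHS]mulr1 ler_pM.
apply: (@le_trans _ _ (mu (ball z (2 * (2 * (2 * r)))))).
  apply: le_outer_measure => y /ballP xy; apply/ballP.
  by have := metric_triangle z x y; lra.
have D0' : 0 <= D%:E by rewrite lee_fin ltW.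
rewrite !EFinM -!muleA.
apply: le_trans (DP _ _ _) _; first by rewrite !mulr_gt0.
apply: lee_wpmul2l => //; apply: le_trans (DP _ _ _) _; first by rewrite !mulr_gt0.
by apply: lee_wpmul2l => //; exact: DP.
Qed.

(** Plain subadditivity; in applications [S] collects the bad points of a
    ball [A], and [T] is the set on which an inequality is wanted. *)
Lemma density_complement (gamma : R) (A S T : set P) : mu A < +oo ->
  A `<=` S `|` T -> mu S <= (1 - gamma)%:E * mu A -> gamma%:E * mu A <= mu T.
Proof.
move=> Afin AST.
have : mu A <= mu S + mu T.
  by apply: le_trans (outer_measureU2 mu S T); exact: le_outer_measure.
have := outer_measure_ge0 mu S; have := outer_measure_ge0 mu A.
case: (mu A) Afin => [a| |]// _; case: (mu S) => [b| |]//; case: (mu T) => [c| |]//.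
- by rewrite -EFinD -!EFinM !lee_fin; lra.
- by move=> *; rewrite leey.
Qed.

Lemma median_ge (gamma t : R) (v : P -> \bar R) (A : set P) :
  gamma%:E * mu A <= mu (A `&` [set x | t%:E <= v x]) ->
  t%:E <= median mu gamma v A.
Proof.
move=> lev; apply/ereal_infP => _ [a /= lta <-]; rewrite lee_fin leNgt.
apply/negP => at_; have := lt_le_trans lta lev; apply/negP; rewrite -leNgt.
apply: le_outer_measure => x [Ax /= tv]; split => //=.
by apply: lt_le_trans tv; rewrite lte_fin.
Qed.

Lemma lt_median (gamma b : R) (v : P -> \bar R) (A : set P) :
  median mu gamma v A < b%:E ->
  mu (A `&` [set x | b%:E < v x]) < gamma%:E * mu A.
Proof.
move=> /ereal_inf_lt[_ [a /= lta <-] ab]; apply: le_lt_trans lta.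
apply: le_outer_measure => x [Ax /= bv]; split => //=.
exact: lt_trans bv.
Qed.

Lemma le_median_maximal (gamma r : R) (v : P -> \bar R) (x : P) : (0 < r < 1)%R ->
  median mu gamma (fun y => `|v y|) (ball x r) <= median_maximal mu gamma 1 v x.
Proof.
by move=> /andP[r0 r1]; apply: ereal_sup_ubound; exists r => //; split => //=; rewrite lte_fin.
Qed.

Lemma median_maximal_ge0 (gamma : R) (v : P -> \bar R) (x : P) :
  (gamma <= 1)%R -> 0 <= median_maximal mu gamma 1 v x.
Proof.
move=> gamma1; apply: le_trans (@le_median_maximal gamma (2^-1)%R v x _); last first.
  by rewrite invr_gt0 ltr0n/= invf_lt1// ltr1n.
apply: median_ge; rewrite (_ : _ `&` _ = ball x (2^-1)%R); last first.
  by apply/seteqP; split => [y []//|y xy]; split => //=; exact: abse_ge0.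
rewrite -[leRHS]mul1e; apply: lee_wpmul2r; first exact: outer_measure_ge0.
by rewrite lee_fin.
Qed.

End metric_measure.

(** * Localization *)

Section cutoff.
Context (R : realType) (P : pmetricType R) (mu : {outer_measure set P -> \bar R}).
Context (z : P) (rho : R).

Definition cutoff (x : P) : R :=
  (Num.min 1 (Num.max 0 (rho + 1 - mdist z x)))%R.

Lemma cutoff01 x : (0 <= cutoff x <= 1)%R.
Proof. by rewrite /cutoff le_min ler01 le_max lexx/= ge_min lexx. Qed.

Lemma cutoff_in x : ball z rho x -> cutoff x = 1%R.
Proof.
move=> /ballP zx; rewrite /cutoff; apply/min_idPl; rewrite le_max.
by apply/orP; right; lra.
Qed.

Lemma cutoff_out x : ~ ball z (rho + 1) x -> cutoff x = 0%R.
Proof.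
move=> /ballP/negP; rewrite -leNgt => zx; rewrite /cutoff (max_idPl _); last lra.
by apply/min_idPr.
Qed.

(** Differences of the cutoff are bounded both by the distance and by 1, hence by
    every power of the distance with exponent between 0 and 1. *)
Lemma cutoff_hoelder (s : R) (x y : P) : (0 < s <= 1)%R ->
  (cutoff x <= cutoff y + mdist x y `^ s)%R.
Proof.
move=> /andP[s0 s1]; have [d1|d1] := leP (mdist x y) 1%R.
  apply: (@le_trans _ _ (cutoff y + mdist x y)%R); last first.
    rewrite lerD2l; have [->|d0] := eqVneq (mdist x y) 0%R; first exact: powR_ge0.
    by apply: ger1_powR => //; rewrite d1 andbT lt_neqAle eq_sym d0 mdist_ge0.
  apply: truncation_lipschitz; first exact: mdist_ge0.
  by have := metric_triangle z x y; lra.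
have /andP[_ x1] := cutoff01 x; have /andP[y0 _] := cutoff01 y.
have : (1 <= mdist x y `^ s)%R.
  rewrite -[leLHS](congr1 (@^~ s) (@powR1 R)).
  by apply: ge0_ler_powR; rewrite ?nnegrE ?mdist_ge0 ?ltW.
lra.
Qed.

Lemma measurable_cutoff : borel_regular mu ->
  cara_measurable_fun mu (fun x => (cutoff x)%:E).
Proof.
move=> mub; apply: cara_measurable_funP => c.
have [c0|c0] := ltP c 0%R.
  rewrite (_ : [set x | _] = setT).
    by apply: caratheodory_open => //; exact: openT.
  by apply/seteqP; split => x //= _; apply: lt_le_trans c0 _; have /andP[] := cutoff01 x.
have [c1|c1] := leP 1%R c.
  rewrite (_ : [set x | _] = set0).
    by apply: caratheodory_open => //; exact: open0.
  apply/seteqP; split => x //=; apply/negP; rewrite -leNgt; apply: le_trans c1.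
  by have /andP[] := cutoff01 x.
have [h|h] := leP (rho + 1 - c)%R 0%R.
  rewrite (_ : [set x | _] = set0).
    by apply: caratheodory_open => //; exact: open0.
  apply/seteqP; split => x //=; rewrite /cutoff lt_min lt_max => /andP[_ /orP[|]].
    by rewrite ltNge c0.
  by have := mdist_ge0 z x; lra.
rewrite (_ : [set x | _] = ball z (rho + 1 - c)); first exact: caratheodory_ball.
apply/seteqP; split => x /=; rewrite /cutoff lt_min lt_max c1/=.
  by move=> /orP[|]; [rewrite ltNge c0|move=> ?; apply/ballP; lra].
by move=> /ballP ?; apply/orP; right; lra.
Qed.

(** The product rule for a Hajlasz gradient and the [s]-Hoelder cutoff. Both
    terms of the new gradient live on the support of the cutoff, so that
    measurability and norms of [G] are only needed there. *)
Lemma cutoff_pair (s : R) (w : P -> R) (G : P -> \bar R) :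
  borel_regular mu -> (0 < s <= 1)%R ->
  cara_measurable_fun mu (fun x => (w x)%:E) -> (forall x, (0 <= w x <= 1)%R) ->
  cara_measurable_fun mu (fun x => G x * (\1_(ball z (rho + 1)) x)%:E) ->
  (forall x, 0 <= G x) ->
  (exists2 E : set P, mu E = 0 & gradient_off s w G E) ->
  test_pair mu s (fun x => cutoff x * w x)%R
    (fun x => (G x + (w x)%:E) * (\1_(ball z (rho + 1)) x)%:E).
Proof.
move=> mub s01 mw w01 mG G0 [E E0 wG].
have w0 x : (0 <= w x)%R by have /andP[] := w01 x.
have c0 x : (0 <= cutoff x)%R by have /andP[] := cutoff01 x.
have c1 x : (cutoff x <= 1)%R by have /andP[] := cutoff01 x.
have Gw0 x : 0 <= (G x + (w x)%:E) * (\1_(ball z (rho + 1)) x)%:E.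
  by rewrite mule_ge0// adde_ge0 ?lee_fin.
split => //.
- under eq_fun do rewrite EFinM.
  by apply: emeasurable_funM => //; exact: measurable_cutoff.
- move=> x; rewrite mulr_ge0//=; have /andP[_ w1] := w01 x.
  by rewrite mulr_ile1.
- under eq_fun => x do rewrite ge0_muleDl ?lee_fin//.
  apply: emeasurable_funD => //; apply: emeasurable_funM => //.
  apply/measurable_EFinP; apply: measurable_indic.
  exact: caratheodory_ball.
have chi_in x : ball z (rho + 1) x -> (\1_(ball z (rho + 1)) x)%:E = 1 :> \bar R.
  by move=> zx; rewrite indicE mem_set.
have chi_out x : ~ ball z (rho + 1) x -> (\1_(ball z (rho + 1)) x)%:E = 0 :> \bar R.
  by move=> zx; rewrite indicE memNset.
exists E => // x y Ex Ey.
have lip := cutoff_hoelder x y s01; move: lip; set D := (mdist x y `^ s)%R => lip.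
have D0 : (0 <= D)%R by exact: powR_ge0.
have [zx|/cutoff_out ->] := pselect (ball z (rho + 1) x); last first.
  by rewrite mul0r adde_ge0 ?lee_fin ?mulr_ge0// mule_ge0 ?lee_fin// adde_ge0.
rewrite (chi_in x zx) mule1.
have [zy|zy] := pselect (ball z (rho + 1) y); last first.
  rewrite (cutoff_out zy) mul0r add0e in lip *.
  rewrite (chi_out y zy) mule0 adde0.
  apply: (@le_trans _ _ (D%:E * (w x)%:E)).
    by rewrite -EFinM lee_fin ler_wpM2r//; rewrite add0r in lip.
  by apply: lee_wpmul2l; rewrite ?lee_fin// leeDr.
rewrite (chi_in y zy) mule1.
have Gf : 0 <= G x + G y by rewrite adde_ge0.
rewrite addeACA (ge0_muleDr _ Gf) ?adde_ge0 ?lee_fin//.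
have := wG x y Ex Ey; rewrite -/D.
have : 0 <= D%:E * (G x + G y) by rewrite mule_ge0.
case: (D%:E * (G x + G y)) => [h| |]//; last by move=> *; rewrite addye// addey// leey.
rewrite -!EFinD !lee_fin => h0 wxy.
have : (cutoff x * w x <= cutoff x * (w y + h))%R by exact: ler_wpM2l.
have : (cutoff x * w y <= (cutoff y + D) * w y)%R by exact: ler_wpM2r.
have : (cutoff x * h <= h)%R by rewrite ler_piMl.
have : (0 <= D * w x)%R by exact: mulr_ge0.
lra.
Qed.

End cutoff.

(** * A regularized median maximal function *)

Section powers.
Context (R : realType) (s : R) (s01 : (0 < s <= 1)%R).

Lemma powR_subadditive (a b : R) : (0 <= a -> 0 <= b ->
  (a + b) `^ s <= a `^ s + b `^ s)%R.
Proof.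
move: s01 => /andP[s0 s1] a0 b0; have [ab0|ab0] := eqVneq (a + b)%R 0%R.
  by rewrite ab0 powR0 ?gt_eqF// addr_ge0 ?powR_ge0.
have ab : (0 < a + b)%R by rewrite lt_neqAle eq_sym ab0 addr_ge0.
have part (c : R) : (0 <= c -> c <= a + b -> (a + b) `^ s * (c / (a + b)) <= c `^ s)%R.
  move=> c0 cab; have [->|cn0] := eqVneq c 0%R; first by rewrite mul0r mulr0 powR_ge0.
  have cgt0 : (0 < c)%R by rewrite lt_neqAle eq_sym cn0.
  rewrite -[X in (_ <= X `^ s)%R](_ : (a + b) * (c / (a + b)) = c)%R; last by field.
  rewrite powRM ?divr_ge0 ?(ltW ab)//; apply: ler_wpM2l; first exact: powR_ge0.
  by apply: ger1_powR => //; rewrite divr_gt0//= ler_pdivrMr// mul1r.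
have pa := part a a0; have pb := part b b0.
apply: le_trans (lerD (pa _) (pb _)); rewrite ?lerDl ?lerDr//.
by rewrite -mulrDr -mulrDl divff// mulr1.
Qed.

Lemma powR_scale (k r : R) : (1 <= k -> 0 <= r -> (k * r) `^ s <= k * r `^ s)%R.
Proof.
move: s01 => /andP[s0 s1] k1 r0; rewrite powRM//; last exact: le_trans k1.
by apply: ler_wpM2r; [exact: powR_ge0|exact: ler1_powR].
Qed.

End powers.

Section regularized_maximal.
Context (R : realType) (P : pmetricType R) (mu : {outer_measure set P -> \bar R}).
Context (mu_balls : balls_pos_finite mu) (s : R) (s01 : (0 < s <= 1)%R).
Context (L : R) (L1 : (1 <= L)%R) (LP : forall (x z : P) (r' r : R), (0 < r)%R ->
  (mdist z x + r' <= 8 * r)%R -> mu (ball x r') <= L%:E * mu (ball z r)).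
Context (gamma : R) (gamma01 : (0 < gamma < 1)%R).

(** The constants are tied together by [tail_density <= gamma], which lets a
    level set meet the points of small gradient, by
    [L * tail_density <= 1 - gamma], which lets the points of small gradient
    fill a neighbouring ball, and by one more factor [L], which turns a small
    proportion of a ball around [x] into one of a nearby smaller ball. *)
Definition tail_density : R := (Num.min gamma (1 - gamma) / L)%R.

Local Notation kappa := tail_density.
Local Notation M := (median_maximal mu (kappa / L)%R 1).

Definition level (phi : P -> R) (z : P) (r t : R) :=
  gamma%:E * mu (ball z r) <= mu (ball z r `&` [set x | (t <= phi x)%R]).

Definition tail (g : P -> \bar R) (z : P) (r a : R) :=
  mu (ball z (4 * r) `&` [set x | a%:E < g x]) < kappa%:E * mu (ball z r).

Let L0 : (0 < L)%R. Proof. exact: lt_le_trans L1. Qed.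

Lemma tail_density_gt0 : (0 < kappa)%R.
Proof. by rewrite divr_gt0// lt_min; move: gamma01 => /andP[? ?]; lra. Qed.

Lemma tail_density_mulr_le : (kappa * L <= gamma)%R /\ (kappa * L <= 1 - gamma)%R.
Proof. by rewrite /kappa divfK ?gt_eqF// !ge_min !lexx orbT. Qed.

Lemma tail_density_le : (kappa <= gamma)%R.
Proof.
apply: le_trans tail_density_mulr_le.1; rewrite -[leLHS]mulr1 ler_wpM2l// ltW//;
  exact: tail_density_gt0.
Qed.

Lemma tail_densityE (m : \bar R) : kappa%:E * m = (kappa / L)%:E * (L%:E * m).
Proof. by rewrite muleA -EFinM divfK// gt_eqF. Qed.

Lemma level_le1 (phi : P -> R) z r t : (forall x, phi x <= 1)%R -> (0 < r)%R ->
  level phi z r t -> (t <= 1)%R.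
Proof.
move=> phi1 r0; rewrite /level leNgt => lev; rewrite leNgt; apply/negP => t1.
move/negP: lev; apply; rewrite (_ : _ `&` _ = set0).
  rewrite outer_measure0 mule_gt0 ?lte_fin//; first by case/andP: gamma01.
  by case/andP: (mu_balls z r0).
apply/seteqP; split => x //= [_ /le_trans /(_ (phi1 x))].
by rewrite leNgt t1.
Qed.

(** Every bound of the median maximal function of [g] at [x] is a tail bound on
    all nearby balls, because these lie in comparable balls around [x]. *)
Lemma tail_of_maximal (g : P -> \bar R) x z r b : (0 < r < 8^-1)%R ->
  (mdist x z < 2 * r)%R -> M g x < b%:E -> tail g z r b.
Proof.
move=> /andP[r0 r8] xz Mb; have r6 : (0 < 6 * r < 1)%R by apply/andP; split; lra.
have := lt_median (le_lt_trans (@le_median_maximal _ _ mu _ _ g x r6) Mb) => lt6.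
apply: (@le_lt_trans _ _ (mu (ball x (6 * r) `&` [set y | b%:E < `|g y|]))).
  apply: le_outer_measure => y [/ballP zy /= bg]; split => /=.
    by apply/ballP; have := metric_triangle x z y; lra.
  by apply: lt_le_trans bg _; exact: lee_abs.
apply: lt_le_trans lt6 _.
rewrite tail_densityE; apply: lee_wpmul2l.
  by rewrite lee_fin divr_ge0 ?ltW// tail_density_gt0.
by apply: LP => //; rewrite metric_sym; lra.
Qed.

Lemma level_le_maximal (phi : P -> R) x z r t : (0 < r < 8^-1)%R ->
  (mdist x z < 2 * r)%R -> level phi z r t ->
  t%:E <= M (fun y => (phi y)%:E) x.
Proof.
move=> /andP[r0 r8] xz lev; have r3 : (0 < 3 * r < 1)%R by apply/andP; split; lra.
apply: le_trans (@le_median_maximal _ _ mu _ _ _ x r3); apply: median_ge.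
apply: (@le_trans _ _ (mu (ball z r `&` [set x | (t <= phi x)%R]))); last first.
  apply: le_outer_measure => y [/ballP zy /= tphi]; split => /=.
    by apply/ballP; have := metric_triangle x z y; lra.
  by rewrite lee_fin (le_trans tphi)// ler_norm.
apply: le_trans lev; apply: (@le_trans _ _ (kappa%:E * mu (ball z r))); last first.
  by apply: lee_wpmul2r; rewrite ?outer_measure_ge0 ?lee_fin ?tail_density_le.
rewrite tail_densityE; apply: lee_wpmul2l.
  by rewrite lee_fin divr_ge0 ?ltW// tail_density_gt0.
by apply: LP => //; rewrite metric_sym; lra.
Qed.

(** The superlevel sets within a ball decrease to a null set of infinite values,
    hence their measures tend to 0. *)
Lemma tail_exists (g : P -> \bar R) z r : borel_regular mu ->
  cara_measurable_fun mu g -> (\forall x \ae cara_measure mu, g x \is a fin_num) ->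
  (0 < r)%R -> exists2 a : R, (0 <= a)%R & tail g z r a.
Proof.
move=> mub mg gfin r0.
pose F n := ball z (4 * r) `&` [set x | n%:R%:E < g x].
have mF n : mu.-caratheodory (F n).
  apply: caratheodory_measurable_setI; first exact: caratheodory_ball.
  exact: cara_measurable_gt.
have F0 : mu (F 0%N) < +oo.
  apply: le_lt_trans (le_outer_measure mu _ _ (@subIsetl _ _ _)) _.
  have r40 : (0 < 4 * r)%R by rewrite mulr_gt0.
  by case/andP: (mu_balls z r40).
have mcap : mu.-caratheodory (\bigcap_n F n).
  have := @bigcapT_measurable _ (caratheodory_type mu) F; exact.
have cap0 : mu (\bigcap_n F n) = 0.
  have [N [mN N0 gN]] := gfin.
  apply/eqP; rewrite eq_le outer_measure_ge0 andbT -[leRHS]N0.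
  apply: le_outer_measure => x Fx; apply: gN => /=.
  case E : (g x) => [a| |]//.
  have := Fx (Num.bound `|a|%R) I; rewrite /F /= E lte_fin => -[_].
    by rewrite ltNge (le_trans (ler_norm a))// ltW// archi_boundP.
have noninc : {homo F : n m / (n <= m)%N >-> (m <= n)%O}.
  move=> n m nm; apply/subsetPset => x [? /= ?]; split => //=.
  by apply: le_lt_trans (_ : _ <= m%:R%:E) _ => //; rewrite lee_fin ler_nat.
have := @nonincreasing_cvg_mu _ (caratheodory_type mu) R (cara_measure mu) F F0 mF mcap noninc.
rewrite /= cap0 => cvgF.
apply: contrapT => Ntail.
have kb : 0 < kappa%:E * mu (ball z r).
  rewrite mule_gt0 ?lte_fin ?tail_density_gt0//.
  by case/andP: (mu_balls z r0).
have cF : cvgn (mu \o F) by apply/cvg_ex; eexists; exact: cvgF.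
have : kappa%:E * mu (ball z r) <= limn (mu \o F).
  apply: lime_ge => //; apply: nearW => n; rewrite leNgt; apply/negP => Fn.
  by apply: Ntail; exists n%:R%R.
rewrite (cvg_lim (@ereal_hausdorff R) cvgF) leNgt => /negP; exact.
Qed.

Section fixed_function.
Context (phi : P -> R) (g : P -> \bar R) (E : set P).
Context (phi01 : forall x, (0 <= phi x <= 1)%R) (g0 : forall x, 0 <= g x).
Context (E0 : mu E = 0) (phig : gradient_off s phi g E).

Lemma gradient_le x y (p q k r : R) : ~ E x -> ~ E y -> g x <= p%:E -> g y <= q%:E ->
  (mdist x y <= k * r)%R -> (1 <= k)%R -> (0 <= r)%R ->
  (phi x <= phi y + k * r `^ s * (p + q))%R.
Proof.
move=> Ex Ey gx gy xy k1 r0; rewrite -lee_fin; apply: le_trans (phig Ex Ey) _.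
rewrite EFinD leeD2l// EFinM EFinD.
apply: (@le_trans _ _ ((mdist x y `^ s)%:E * (p%:E + q%:E))).
  by apply: lee_wpmul2l; rewrite ?lee_fin ?powR_ge0// leeD.
apply: lee_wpmul2r; first by rewrite adde_ge0// (le_trans _ gx, le_trans _ gy).
rewrite lee_fin; apply: le_trans (powR_scale s01 k1 r0).
case/andP: s01 => s0 _; apply: ge0_ler_powR; rewrite ?nnegrE ?mdist_ge0 ?(ltW s0)//.
by apply: mulr_ge0 => //; apply: le_trans k1.
Qed.

(** The points with large gradient are too few to cover the level set. *)
Lemma level_point z r t a : (0 < r)%R -> level phi z r t -> tail g z r a ->
  exists2 b, ball z r b & [/\ ~ E b, (t <= phi b)%R & g b <= a%:E].
Proof.
move=> r0 lev tl; apply: contrapT => Nb.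
suff : gamma%:E * mu (ball z r) < gamma%:E * mu (ball z r) by rewrite ltxx.
apply: le_lt_trans lev _.
apply: (@le_lt_trans _ _ (mu E + mu (ball z (4 * r) `&` [set x | a%:E < g x]))).
  apply: le_trans (outer_measureU2 mu _ _); apply: le_outer_measure => x [zx /= tx].
  have [Ex|Ex] := pselect (E x); [by left|right; split].
    by apply/ballP; move/ballP: zx; lra.
  by rewrite /= ltNge; apply/negP => ga; apply: Nb; exists x.
rewrite E0 add0e; apply: lt_le_trans tl _.
by apply: lee_wpmul2r; rewrite ?outer_measure_ge0 ?lee_fin ?tail_density_le.
Qed.

(** A point of the level set with gradient at most [a] bounds [phi] from below at
    all points with gradient at most [a] of the ball around [y], and these have
    proportion at least [gamma]. The loss is [(5 r) ^ s * (a + a)], as such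
    points have distance at most [5 r]. *)
Lemma level_transfer z y r t a : (0 < r)%R -> (0 <= a)%R -> (mdist y z < 3 * r)%R ->
  level phi z r t -> tail g z r a -> level phi y r (t - 10 * a * r `^ s)%R.
Proof.
move=> r0 a0 yz lev tl; have [b zb [Eb tb gb]] := level_point r0 lev tl.
move/ballP: zb => zb.
apply: (@density_complement _ _ mu gamma _ (E `|` (ball z (4 * r) `&` [set x | a%:E < g x]))).
- by case/andP: (mu_balls y r0).
- move=> w /ballP yw; have [Ew|Ew] := pselect (E w); first by left; left.
  have [gw|gw] := ltP a%:E (g w).
    left; right; split => //; apply/ballP.
    by have := metric_triangle z y w; rewrite (metric_sym z y); lra.
  right; split; first exact/ballP.
  have bw : (mdist b w <= 5 * r)%R.
    have := metric_triangle b z w; have := metric_triangle z y w.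
    by rewrite (metric_sym b z) (metric_sym z y); lra.
  have := gradient_le Eb Ew gb gw bw _ (ltW r0); rewrite ler1n => /(_ isT) /=.
  have -> : (5 * r `^ s * (a + a) = 10 * a * r `^ s)%R by ring.
  by move=> ?; lra.
- apply: le_trans (outer_measureU2 mu _ _) _; rewrite E0 add0e.
  apply: le_trans (ltW tl) _; apply: (@le_trans _ _ (kappa%:E * (L%:E * mu (ball y r)))).
    by apply: lee_wpmul2l; [rewrite lee_fin ltW// tail_density_gt0|apply: LP => //; lra].
  rewrite muleA -EFinM; apply: lee_wpmul2r; first exact: outer_measure_ge0.
  by rewrite lee_fin tail_density_mulr_le.2.
Qed.

(** The slope [10 a] matches the loss in [level_transfer]: where a ball stops
    contributing, its contribution is below the level that a neighbouring ball
    has by transfer. The value 0 keeps the set nonempty and its supremum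
    nonnegative. *)
Definition candidates (x : P) : set R := [set v | v = 0%R \/
  exists (z : P) (r t a : R), [/\ (0 < r < 8^-1)%R, (mdist x z < 2 * r)%R, (0 <= a)%R,
    level phi z r t /\ tail g z r a & v = (t - 10 * a * mdist x z `^ s)%R]].

Definition regularized (x : P) : R := sup (candidates x).

Let s0 : (0 < s)%R. Proof. by case/andP: s01. Qed.

Lemma phi_le1 x : (phi x <= 1)%R. Proof. by case/andP: (phi01 x). Qed.

Lemma candidates_le1 x v : candidates x v -> (v <= 1)%R.
Proof.
move=> [->//|[z [r [t [a [/andP[r0 _] xz a0 [lev tl] ->]]]]]].
apply: le_trans (level_le1 phi_le1 r0 lev); rewrite lerBlDr lerDl.
by rewrite !mulr_ge0// powR_ge0.
Qed.

Lemma candidates_sup x : has_sup (candidates x).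
Proof.
by split; [exists 0%R; left|exists 1%R => v; exact: candidates_le1].
Qed.

Lemma regularized_ge x v : candidates x v -> (v <= regularized x)%R.
Proof. by move=> xv; apply: ub_le_sup => //; case: (candidates_sup x). Qed.

Lemma regularized_le x (m : R) : (forall v, candidates x v -> (v <= m)%R) ->
  (regularized x <= m)%R.
Proof. by move=> xm; apply: ge_sup => //; case: (candidates_sup x). Qed.

Lemma regularized01 x : (0 <= regularized x <= 1)%R.
Proof.
apply/andP; split; first by apply: regularized_ge; left.
by apply: regularized_le => v; exact: candidates_le1.
Qed.

(** A candidate persists in a neighbourhood of [x] with almost the same value,
    since its defining ball, level and slope can be kept. *)
Lemma regularized_superlevel_open (c : R) : open [set x | (c < regularized x)%R].
Proof.
apply: open_of_balls => x /= /sup_gt[]; first by exists 0%R; left.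
move=> v [->|[z [r [t [a [r01 xz a0 lt_ vE]]]]]] cv.
  exists 1%R => // y _ /=; apply: lt_le_trans cv _.
  by case/andP: (regularized01 y).
have a1 : (0 < 10 * a + 1)%R by rewrite ltr_wpDl// mulr_ge0.
pose e := ((v - c) / (10 * a + 1))%R.
have e0 : (0 < e)%R by rewrite divr_gt0// subr_gt0.
exists (Num.min (2 * r - mdist x z) (e `^ s^-1))%R.
  by rewrite lt_min subr_gt0 xz powR_gt0.
move=> y /ballP; rewrite lt_min => /andP[xy1 xy2] /=.
have yz : (mdist y z < 2 * r)%R.
  by have := metric_triangle y x z; rewrite (metric_sym y x); lra.
apply: (@lt_le_trans _ _ (t - 10 * a * mdist y z `^ s)%R); last first.
  by apply: regularized_ge; right; exists z, r, t, a.
have xye : (mdist x y `^ s < e)%R.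
  rewrite [ltRHS](_ : e = (e `^ s^-1) `^ s)%R; last first.
    by rewrite -powRrM mulVf ?gt_eqF// powRr1// ltW.
  by apply: gt0_ltr_powR => //; rewrite nnegrE ?mdist_ge0 ?powR_ge0.
have yzs : (mdist y z `^ s <= mdist x y `^ s + mdist x z `^ s)%R.
  apply: le_trans (powR_subadditive s01 (mdist_ge0 x y) (mdist_ge0 x z)).
  apply: ge0_ler_powR; rewrite ?nnegrE ?mdist_ge0 ?addr_ge0 ?mdist_ge0 ?(ltW s0)//.
  by rewrite (metric_sym x y); exact: metric_triangle.
have : (10 * a * mdist y z `^ s <= 10 * a * (e + mdist x z `^ s))%R.
  by apply: ler_wpM2l; [rewrite mulr_ge0|lra].
have : (e * (10 * a + 1) = v - c)%R by rewrite divfK// gt_eqF.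
by rewrite vE in e e0 xy2 xye *; lra.
Qed.

Lemma regularized_le_maximal x :
  (regularized x)%:E <= M (fun y => (phi y)%:E) x.
Proof.
have M0 : 0 <= M (fun y => (phi y)%:E) x.
  apply: median_maximal_ge0; rewrite ler_pdivrMr// mul1r (le_trans tail_density_le)//.
  by case/andP: gamma01 => _ /ltW /le_trans; apply.
have : forall v, candidates x v -> v%:E <= M (fun y => (phi y)%:E) x.
  move=> v [->//|[z [r [t [a [r01 xz a0 [lev _] ->]]]]]].
  apply: le_trans (level_le_maximal r01 xz lev); rewrite lee_fin lerBlDr lerDl.
  by rewrite !mulr_ge0// powR_ge0.
case: (M _ x) M0 => [m| |] //= _ xm; last by rewrite leey.
by rewrite lee_fin; apply: regularized_le => v /xm.
Qed.

(** The ball around [x] itself contributes its full level at [x]. *)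
Lemma regularized_ge1 x r : borel_regular mu -> cara_measurable_fun mu g ->
  (\forall x \ae cara_measure mu, g x \is a fin_num) ->
  (0 < r < 8^-1)%R -> level phi x r 1 -> (1 <= regularized x)%R.
Proof.
move=> mub mg gfin r01 lev; have r0 : (0 < r)%R by case/andP: r01.
have [a a0 tl] := tail_exists x mub mg gfin r0.
apply: regularized_ge; right; exists x, r, 1%R, a; split => //.
  by rewrite mdistxx mulr_gt0.
by rewrite mdistxx powR0 ?gt_eqF// mulr0 subr0.
Qed.

(** The interplay of the scale [r] of a candidate with the distance of the two
    points. Below the distance, the candidate is controlled by the values of
    [phi]; above it, the same ball is a candidate for [y], unless it leaves the
    reach of [y], in which case its level has dropped enough to pass to the ball
    of [y] itself. *)
Lemma candidate_le x y v (p q m n : R) : ~ E x -> ~ E y -> x != y ->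
  g x = p%:E -> g y = q%:E -> M g x < m%:E -> M g y < n%:E ->
  (0 <= m)%R -> (0 <= n)%R -> candidates x v ->
  (v <= Num.max (phi y) (regularized y) + 10 * mdist x y `^ s * (p + q + m))%R.
Proof.
move=> Ex Ey xy gx gy Mx My m0 n0.
have p0 : (0 <= p)%R by rewrite -lee_fin -gx.
have q0 : (0 <= q)%R by rewrite -lee_fin -gy.
set D := (mdist x y `^ s)%R; have D0 : (0 <= D)%R by exact: powR_ge0.
have Dpqm : (0 <= D * p /\ 0 <= D * q /\ 0 <= D * m)%R by rewrite !mulr_ge0.
have phiT : (phi y <= Num.max (phi y) (regularized y))%R by rewrite le_max lexx.
have regT : (regularized y <= Num.max (phi y) (regularized y))%R.
  by rewrite le_max lexx orbT.
have /andP[reg0 _] := regularized01 y.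
move=> [->|[z [r [t [a [r01 xz a0 [lev tl] vE]]]]]]; first by lra.
have r0 : (0 < r)%R by case/andP: r01.
(* the slope [a] may be lowered to the size of the maximal function at [x] *)
pose b := Num.min a m.
have b0 : (0 <= b)%R by rewrite le_min a0.
have bm : (b <= m)%R by rewrite ge_min lexx orbT.
have tlb : tail g z r b.
  by rewrite /b; case: leP => // _; exact: tail_of_maximal r01 xz Mx.
have vb : (v <= t - 10 * b * mdist x z `^ s)%R.
  rewrite vE lerD2l lerN2 ler_wpM2r ?powR_ge0// ler_wpM2l//.
  by rewrite ge_min lexx.
have Db : (D * b <= D * m)%R by exact: ler_wpM2l.
have dxz0 : (0 <= 10 * b * mdist x z `^ s)%R by rewrite !mulr_ge0// powR_ge0.
(* small balls: compare with [phi x] through a point of the level set *)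
have [rd|dr] := leP r (mdist x y).
  have [w zw [Ew tw gw]] := level_point r0 lev tlb.
  have xw : (mdist w x <= 3 * mdist x y)%R.
    move/ballP: zw => zw; have := metric_triangle x z w.
    by rewrite (metric_sym w x); lra.
  have := gradient_le Ew Ex gw _ xw _ (mdist_ge0 x y).
  rewrite gx => /(_ _ (lexx _)); rewrite ler1n => /(_ isT); rewrite -/D => wx.
  have := @gradient_le x y p q 1%R (mdist x y) Ex Ey.
  rewrite gx gy !mul1r => /(_ (lexx _) (lexx _) (lexx _) (lexx _) (mdist_ge0 x y)).
  rewrite -/D => xy'.
  lra.
(* large balls within reach of [y] *)
have [yz|yz] := ltP (mdist y z) (2 * r)%R.
  have : (t - 10 * b * mdist y z `^ s <= regularized y)%R.
    by apply: regularized_ge; right; exists z, r, t, b.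
  have yzs : (mdist y z `^ s <= D + mdist x z `^ s)%R.
    apply: le_trans (powR_subadditive s01 (mdist_ge0 x y) (mdist_ge0 x z)).
    apply: ge0_ler_powR; rewrite ?nnegrE ?mdist_ge0 ?addr_ge0 ?mdist_ge0 ?(ltW s0)//.
    by rewrite (metric_sym x y); exact: metric_triangle.
  have : (10 * b * mdist y z `^ s <= 10 * b * (D + mdist x z `^ s))%R.
    by apply: ler_wpM2l => //; rewrite mulr_ge0.
  by lra.
(* large balls out of reach of [y], whose contribution at [x] has dropped *)
have xzr : (r <= mdist x z)%R.
  by have := metric_triangle y x z; rewrite (metric_sym y x); lra.
have yz3 : (mdist y z < 3 * r)%R.
  by have := metric_triangle y x z; rewrite (metric_sym y x); lra.
have levy := level_transfer r0 b0 yz3 lev tlb.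
have : (t - 10 * b * r `^ s <= regularized y)%R.
  apply: regularized_ge; right; exists y, r, (t - 10 * b * r `^ s)%R, n; split => //.
  - by rewrite mdistxx mulr_gt0.
  - split => //; apply: tail_of_maximal r01 _ My.
    by rewrite mdistxx mulr_gt0.
  - by rewrite mdistxx powR0 ?gt_eqF// mulr0 subr0.
have : (10 * b * r `^ s <= 10 * b * mdist x z `^ s)%R.
  apply: ler_wpM2l; first by rewrite mulr_ge0.
  by apply: ge0_ler_powR; rewrite ?nnegrE ?mdist_ge0 ?(ltW s0) ?(ltW r0).
lra.
Qed.

(** The maximum with [phi] is needed because a candidate from a ball smaller than
    [mdist x y] is compared with the value of [phi] at [y]. *)
Lemma regularized_gradient x y : ~ E x -> ~ E y ->
  (Num.max (phi x) (regularized x))%:E <=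
  (Num.max (phi y) (regularized y))%:E +
    (mdist x y `^ s)%:E * (10%:E * (g x + M g x) + 10%:E * (g y + M g y)).
Proof.
move=> Ex Ey; have kL1 : (kappa / L <= 1)%R.
  rewrite ler_pdivrMr// mul1r (le_trans tail_density_le)//.
  by case/andP: gamma01 => _ /ltW /le_trans; apply.
have Mg0 w : 0 <= M g w by apply: median_maximal_ge0.
pose G w := 10%:E * (g w + M g w); rewrite -/(G x) -/(G y).
have G0 w : 0 <= G w by rewrite mule_ge0// adde_ge0.
have [->|xy] := eqVneq x y; first by rewrite leeDl// mule_ge0 ?lee_fin ?powR_ge0// adde_ge0.
have D0 : (0 < mdist x y `^ s)%R by rewrite powR_gt0// mdist_gt0.
have GDy : G x + G y = +oo -> (Num.max (phi x) (regularized x))%:E <=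
    (Num.max (phi y) (regularized y))%:E + (mdist x y `^ s)%:E * (G x + G y).
  by move=> ->; rewrite gt0_muley ?lte_fin// addey// leey.
have Goo w : g w = +oo \/ M g w = +oo -> G w = +oo.
  move=> goo; rewrite /G (_ : g w + M g w = +oo) ?gt0_muley ?lte_fin//.
  by case: goo => ->; rewrite ?addye ?addey// -ltNye (lt_le_trans _ (Mg0 w), lt_le_trans _ (g0 w)).
have [Gx|Gx] := eqVneq (G x) +oo.
  by apply: GDy; rewrite Gx addye// -ltNye (lt_le_trans _ (G0 _)).
have [Gy|Gy] := eqVneq (G y) +oo.
  by apply: GDy; rewrite Gy addey// -ltNye (lt_le_trans _ (G0 _)).
have fin w : G w != +oo -> exists p m : R, [/\ (0 <= m)%R, g w = p%:E & M g w = m%:E].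
  have := Goo w; have := g0 w; have := Mg0 w.
  case: (M g w) => [m| |]//; case: (g w) => [p| |]// => m0 _ H Gw.
  - by exists p, m.
  - by move: Gw; rewrite H ?eqxx//; left.
  - by move: Gw; rewrite H ?eqxx//; right.
  - by move: Gw; rewrite H ?eqxx//; right.
have [p [m [m0 gx Mx]]] := fin x Gx; have [q [n [n0 gy My]]] := fin y Gy.
rewrite /G gx gy Mx My -!EFinD lee_fin.
apply/ler_addgt0Pr => e e0; set D := (mdist x y `^ s)%R in D0 *.
(* a tail bound has to exceed the maximal function strictly *)
pose m' := (m + e / (10 * D))%R.
have De : (D * (e / (10 * D)) = e / 10)%R by field; rewrite gt_eqF.
have eD : (0 < e / (10 * D))%R by rewrite divr_gt0// mulr_gt0.
have mm' : M g x < m'%:E by rewrite Mx lte_fin ltrDl.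
have nn' : M g y < (n + 1)%:E by rewrite My lte_fin ltrDl.
have m'0 : (0 <= m')%R by rewrite addr_ge0// ltW.
have n'0 : (0 <= n + 1)%R by rewrite addr_ge0.
have q0 : (0 <= D * q)%R by rewrite mulr_ge0 ?(ltW D0)// -lee_fin -gy.
have Dn : (0 <= D * n)%R by rewrite mulr_ge0 ?(ltW D0).
have Dm : (0 <= D * m)%R by rewrite mulr_ge0 ?(ltW D0).
have Dp : (0 <= D * p)%R by rewrite mulr_ge0 ?(ltW D0)// -lee_fin -gx.
rewrite ge_max; apply/andP; split.
  have := @gradient_le x y p q 1%R (mdist x y) Ex Ey.
  rewrite gx gy !mul1r => /(_ (lexx _) (lexx _) (lexx _) (lexx _) (mdist_ge0 x y)).
  have : (phi y <= Num.max (phi y) (regularized y))%R by rewrite le_max lexx.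
  by rewrite -/D; lra.
apply: regularized_le => v xv.
have := candidate_le Ex Ey xy gx gy mm' nn' m'0 n'0 xv; rewrite -/D /m'.
by lra.
Qed.

End fixed_function.

End regularized_maximal.

(** * Capacity of the points of positive density *)

Definition maximal_bounded (R : realType) (P : pmetricType R)
    (mu : {outer_measure set P -> \bar R}) (X : qbfs mu) :=
  forall gamma : R, (0 < gamma < 1)%R ->
  forall (z : P) (r : R), (0 < r)%R ->
  exists C : R, forall g : P -> \bar R, qcarrier X g ->
    qnorm X (fun x => median_maximal mu gamma 1 g x * (\1_(ball z r) x)%:E)
      <= C%:E * qnorm X g.

Section capacity_of_density.
Context (R : realType) (P : pmetricType R) (mu : {outer_measure set P -> \bar R}).
Context (mu_borel_regular : borel_regular mu) (mu_balls : balls_pos_finite mu)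
  (mu_doubling : doubling mu) (X : qbfs mu).
Context (X_maximal : maximal_bounded X).
Context (s : R) (s01 : (0 < s <= 1)%R).

(** Measurability of the localized maximal function comes for free: a finite
    norm puts it into the space. *)
Lemma qnorm_maximal (gamma : R) (z : P) (r : R) : (0 < gamma < 1)%R -> (0 < r)%R ->
  exists2 C : R, (0 <= C)%R & forall (g : P -> \bar R) (d : R),
    qnorm X g <= d%:E ->
    let h := fun x => median_maximal mu gamma 1 g x * (\1_(ball z r) x)%:E in
    cara_measurable_fun mu h /\ qnorm X h <= (C * d)%:E.
Proof.
move=> gamma01 r0; have [C CP] := X_maximal gamma01 z r0.
exists (Num.max C 0%R) => [|g d gd h]; first by rewrite le_max lexx orbT.
have Xg : qcarrier X g by apply: qnorm_carrier; apply: le_lt_trans gd (ltry _).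
have hd : qnorm X h <= (Num.max C 0 * d)%:E.
  apply: le_trans (CP g Xg) _.
  apply: (@le_trans _ _ ((Num.max C 0)%:E * qnorm X g)).
    by apply: lee_wpmul2r; rewrite ?qnorm_ge0// lee_fin le_max lexx.
  by rewrite EFinM; apply: lee_wpmul2l => //; rewrite lee_fin le_max lexx orbT.
split=> //; have Xh : qcarrier X h by apply: qnorm_carrier; apply: le_lt_trans hd (ltry _).
by have [/(_ h Xh)[]] := qbfs_subspace X.
Qed.

Lemma qbfs_L0 (g : P -> \bar R) (d : R) : qnorm X g <= d%:E ->
  \forall x \ae cara_measure mu, g x \is a fin_num.
Proof.
move=> gd; have Xg : qcarrier X g by apply: qnorm_carrier; apply: le_lt_trans gd (ltry _).
by have [/(_ g Xg)[]] := qbfs_subspace X.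
Qed.

(** The test function is [min(1, 2 T)] for the maximum [T] of [phi] and
    [regularized], times a cutoff. The factor 2 leaves room for an open set:
    [regularized] is at least 1 at the points in question, hence above 1/2 in a
    neighbourhood. *)
Lemma small_capacity_density (gamma : R) (z0 : P) (rho : R) :
  (0 < gamma < 1)%R -> (0 < rho)%R ->
  exists2 K : R, (0 < K)%R & forall (phi : P -> R) (g : P -> \bar R) (d : R),
    (0 < d)%R -> test_pair mu s phi g ->
    qnorm X (fun x => (phi x)%:E) <= d%:E -> qnorm X g <= d%:E ->
    small_capacity s X [set x | ball z0 rho x /\
      exists2 r : R, (0 < r < 8^-1)%R & level mu gamma phi x r 1] (K * d).
Proof.
move=> gamma01 rho0; have [L L1 LP] := doubling_balls mu_doubling.
have L0 : (0 < L)%R by apply: lt_le_trans L1.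
set kappa := tail_density L gamma; pose kL := (kappa / L)%R.
have kL01 : (0 < kL < 1)%R.
  have k0 : (0 < kappa)%R by apply: tail_density_gt0.
  rewrite divr_gt0//= ltr_pdivrMr// mul1r.
  apply: le_lt_trans (tail_density_le _ gamma01) _ => //.
  by case/andP: gamma01 => *; exact: lt_le_trans L1.
pose M := median_maximal mu kL 1.
have rho10 : (0 < rho + 1)%R by rewrite addr_gt0.
have [C C0 CP] := qnorm_maximal z0 kL01 rho10.
have [c c1 cP] := qnormD X; have c0 : (0 < c)%R by apply: lt_le_trans c1.
pose K := (c * (1 + C))%R.
have K0 : (0 < K)%R by rewrite mulr_gt0// ltr_wpDr.
exists (20 * (c * (K + K)))%R; first by rewrite !mulr_gt0// addr_gt0.
move=> phi g d d0 [mphi phi01 mg g0 [E E0 phig]] Nphi Ng.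
pose chi x : \bar R := (\1_(ball z0 (rho + 1)) x)%:E.
have chi_in x : ball z0 (rho + 1) x -> chi x = 1.
  by move=> zx; rewrite /chi indicE mem_set.
have chi_out x : ~ ball z0 (rho + 1) x -> chi x = 0.
  by move=> zx; rewrite /chi indicE memNset.
have chi0 x : 0 <= chi x by rewrite lee_fin.
have mchi : cara_measurable_fun mu chi.
  apply/measurable_EFinP; apply: measurable_indic; exact: caratheodory_ball.
have [mMg NMg] := CP g d Ng; have [mMphi NMphi] := CP _ d Nphi.
rewrite -/M -/chi in mMg NMg mMphi NMphi.
have Mv0 v x : 0 <= M v x.
  by apply: median_maximal_ge0; case/andP: kL01 => _ /ltW.
pose F := regularized mu s L gamma phi g.
pose T x := Num.max (phi x) (F x).
have F01 x : (0 <= F x <= 1)%R by apply: regularized01.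
have T0 x : (0 <= T x)%R by rewrite le_max; case/andP: (phi01 x) => ->.
have mF : cara_measurable_fun mu (fun x => (F x)%:E).
  apply: cara_measurable_funP => b; apply: caratheodory_open => //.
  exact: regularized_superlevel_open.
have TM x : (T x)%:E <= (phi x)%:E + M (fun y => (phi y)%:E) x.
  have p0 : 0 <= (phi x)%:E by rewrite lee_fin; case/andP: (phi01 x).
  rewrite EFin_max ge_max; apply/andP; split; first by rewrite leeDl.
  by apply: le_trans (regularized_le_maximal _ _ _ _ _ _ _ _) _; rewrite ?leeDr.
pose A x := 10%:E * (g x + M g x).
have A0 x : 0 <= A x by rewrite mule_ge0// adde_ge0.
pose G x := 2%:E * A x.
have G0 x : 0 <= G x by rewrite mule_ge0.
(* a common majorant of the test function and of its gradient *)
pose H x := 20%:E * ((g x + M g x * chi x) +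
  ((phi x)%:E + M (fun y => (phi y)%:E) x * chi x)).
have H0 x : 0 <= H x.
  by rewrite mule_ge0// !adde_ge0// ?mule_ge0// lee_fin; case/andP: (phi01 x).
have NH : qnorm X H <= (20 * (c * (K + K)) * d)%:E.
  apply: le_trans (@qnormZ _ _ _ X 20%R _ _) _; first by rewrite ltr0n.
  rewrite -!mulrA EFinM; apply: lee_wpmul2l; first by rewrite lee_fin.
  apply: le_trans (cP _ _) _; rewrite EFinM; apply: lee_wpmul2l; first by rewrite lee_fin ltW.
  have Kd (a : R) : a = d -> (c * (a + C * d))%R = (K * d)%R.
    by move=> ->; rewrite /K; ring.
  rewrite mulrDl EFinD; apply: leeD; apply: le_trans (cP _ _) _;
    rewrite -(Kd d erefl) EFinM EFinD; apply: lee_wpmul2l; rewrite ?lee_fin ?(ltW c0)//;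
    exact: leeD.
pose w x := Num.min 1%R (2 * T x)%R.
have w01 x : (0 <= w x <= 1)%R.
  by rewrite /w le_min ler01 mulr_ge0//= ge_min lexx.
have mw : cara_measurable_fun mu (fun x => (w x)%:E).
  under eq_fun do rewrite EFin_min EFinM EFin_max.
  apply: measurable_mine; first exact: measurable_cst.
  by apply: emeasurable_funM; [exact: measurable_cst|exact: measurable_maxe].
have wT x : (w x)%:E <= 2%:E * (T x)%:E by rewrite -EFinM lee_fin ge_min lexx orbT.
have wgrad x y : ~ E x -> ~ E y ->
    (w x)%:E <= (w y)%:E + (mdist x y `^ s)%:E * (G x + G y).
  move=> Ex Ey.
  have : (T x)%:E <= (T y)%:E + (mdist x y `^ s)%:E * (A x + A y) :=
    regularized_gradient mu_balls s01 L1 LP gamma01 phi01 g0 E0 phig Ex Ey.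
  rewrite /G -(@ge0_muleDr _ 2%:E)// muleCA.
  have : 0 <= (mdist x y `^ s)%:E * (A x + A y).
    by rewrite mule_ge0// ?lee_fin ?powR_ge0// adde_ge0.
  case: ((mdist x y `^ s)%:E * (A x + A y)) => [h| |]// h0; last first.
    by move=> _; rewrite gt0_muley ?lte_fin// addey// leey.
  rewrite -EFinM -!EFinD !lee_fin /w in h0 * => Txy.
  by rewrite /Num.min; do 2 (case: ifPn; rewrite -?leNgt); lra.
have mG : cara_measurable_fun mu (fun x => G x * chi x).
  rewrite (_ : (fun _ => _) = fun x => 20%:E * (g x * chi x + M g x * chi x)).
    apply: emeasurable_funM; first exact: measurable_cst.
    by apply: emeasurable_funD => //; exact: emeasurable_funM.
  apply/funext => x; rewrite /G /A muleA -EFinM -ge0_muleDl// muleA.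
  by congr (_%:E * _ * _); ring.
have pair := cutoff_pair (z := z0) (rho := rho) mu_borel_regular s01 mw w01 mG G0
  (ex_intro2 _ _ E E0 wgrad).
have [mpsi psi01 mGw Gw0 _] := pair.
have wH x : ball z0 (rho + 1) x -> G x + (w x)%:E <= H x.
  move=> zx; rewrite /H (chi_in _ zx) !mule1 ge0_muleDr ?adde_ge0//; last first.
    by rewrite lee_fin; case/andP: (phi01 x).
  apply: leeD; first by
    rewrite /G /A muleA -EFinM; apply: lee_wpmul2r; rewrite ?adde_ge0// lee_fin; lra.
  apply: le_trans (wT x) _.
  apply: (@le_trans _ _ (20%:E * (T x)%:E)).
    by rewrite -!EFinM lee_fin ler_wpM2r//; lra.
  by apply: lee_wpmul2l; rewrite ?lee_fin.
exists (fun x => cutoff z0 rho x * w x)%R.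
exists (fun x => (G x + (w x)%:E) * chi x); split => //.
- apply: le_trans NH; apply: le_qnorm => // x.
  rewrite !gee0_abs// ?lee_fin; last by case/andP: (psi01 x).
  have [zx|/cutoff_out ->] := pselect (ball z0 (rho + 1) x); last by rewrite mul0r.
  apply: le_trans (wH x zx); apply: (@le_trans _ _ (w x)%:E); last by rewrite leeDr.
  rewrite lee_fin ler_piMl//; first by case/andP: (w01 x).
  by case/andP: (cutoff01 z0 rho x).
- apply: le_trans NH; apply: le_qnorm => // x; rewrite !gee0_abs//.
  have [zx|zx] := pselect (ball z0 (rho + 1) x); last by rewrite (chi_out _ zx) mule0.
  by rewrite (chi_in _ zx) mule1 wH.
- exists (ball z0 rho `&` [set x | (2^-1 < F x)%R]); split.
  + by apply: openI; [exact: open_metric_ball|exact: regularized_superlevel_open].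
  + move=> x [zx [r r01 lev]]; split => //=.
    have F1 : (1 <= F x)%R by apply: regularized_ge1 lev => //; exact: qbfs_L0 Ng.
    by lra.
  + move=> x [zx /= Fx]; rewrite (cutoff_in zx) mul1r /w le_min lexx/=.
    have : (F x <= T x)%R by rewrite le_max lexx orbT.
    lra.
Qed.

End capacity_of_density.

(** * Approximate continuity and medians *)

Section ereal_limits.
Context (R : realType).

Lemma nbhs_ereal_dist (a eta : R) : (0 < eta)%R ->
  nbhs a%:E [set y : \bar R | `|y - a%:E| <= eta%:E].
Proof.
move=> eta0; change (nbhs a [set b : R | (`|b - a| <= eta)%R]).
by apply/nbhs_ballP; exists eta => // b; rewrite /ball/= distrC => /ltW.
Qed.

Lemma cvg_ereal_bounds (T : Type) (F : set_system T) (FF : Filter F)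
    (f : T -> \bar R) (a : R) :
  (forall eta : R, (0 < eta)%R ->
    \forall r \near F, (a - eta)%:E <= f r <= (a + eta)%:E) ->
  f r @[r --> F] --> a%:E.
Proof.
move=> fa A Aa; have : nbhs a [set b : R | A b%:E] := Aa.
move=> /nbhs_ballP[e /= e0 eA].
have e20 : (0 < e / 2)%R by rewrite divr_gt0.
apply: filterS (fa _ e20) => r; case fr : (f r) => [b| |]; last 2 first.
- by move=> /andP[_]; rewrite leye_eq.
- by move=> /andP[]; rewrite leeNy_eq.
rewrite !lee_fin => /andP[ab ba]; change (A (f r)); rewrite fr; apply: eA.
by rewrite /ball/= ltr_norml; apply/andP; split; lra.
Qed.

End ereal_limits.

Section approximate_continuity.
Context (R : realType) (P : pmetricType R) (mu : {outer_measure set P -> \bar R}).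
Context (mu_balls : balls_pos_finite mu).

(** Approximate continuity in the usual sense is the conjunction over all
    [gamma > 0]; the set [U] may depend on [gamma]. *)
Definition approx_continuous (gamma : R) (u : P -> \bar R) (x : P) :=
  exists U : set P, u y @[y --> within (~` U) (nbhs x)] --> u x /\
    \forall r \near 0^'+, mu (ball x r `&` U) < gamma%:E * mu (ball x r).

Lemma within_near_ball (U : set P) (x : P) (A : set P) :
  (\forall y \near within (~` U) (nbhs x), A y) ->
  \forall r \near 0^'+, ball x r `&` ~` U `<=` A.
Proof.
move=> /nbhs_ballP[e /= e0 eA]; near=> r => y [xy Uy]; apply: eA => //.
apply: le_ball xy; near: r; exact: nbhs_right_le.
Unshelve. all: by end_near. Qed.

(** Outside a set of small density [u] is close to [u x], hence medians of
    any order between that density and its complement are close to [u x]. *)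
Lemma median_limits (gamma delta : R) (u : P -> \bar R) (x : P) :
  (0 < gamma < 1)%R -> (delta <= gamma)%R -> (delta <= 1 - gamma)%R ->
  u x \is a fin_num -> approx_continuous delta u x ->
  median mu gamma (fun y => `|u y - u x|) (ball x r) @[r --> 0^'+] --> 0 /\
  median mu gamma u (ball x r) @[r --> 0^'+] --> u x.
Proof.
move=> /andP[g0 g1] dg dg1 /fineK; set a := fine _ => ua [U [ux Ud]].
rewrite -ua in ux *.
have close (eta : R) : (0 < eta)%R -> \forall r \near 0^'+,
    [/\ (0 < r)%R, mu (ball x r `&` U) < delta%:E * mu (ball x r) &
    ball x r `&` ~` U `<=` [set y | `|u y - a%:E| <= eta%:E]].
  move=> eta0; near=> r; split; near: r; [exact: nbhs_right_gt|exact: Ud|].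
  exact: (within_near_ball (ux _ (nbhs_ereal_dist a eta0))).
have upper (v : P -> \bar R) (b : R) r : (0 < r)%R ->
    mu (ball x r `&` U) < delta%:E * mu (ball x r) ->
    ball x r `&` ~` U `<=` [set y | v y <= b%:E] ->
    median mu gamma v (ball x r) <= b%:E.
  move=> r0 Ur vb; apply: ereal_inf_lbound; exists b => //=.
  apply: (@le_lt_trans _ _ (mu (ball x r `&` U))).
    apply: le_outer_measure => y [xy /= bv]; split => //.
    by apply: contrapT => Uy; move: bv; rewrite ltNge vb.
  apply: lt_le_trans Ur _; apply: lee_wpmul2r; first exact: outer_measure_ge0.
  by rewrite lee_fin.
have lower (v : P -> \bar R) (b : R) r : (0 < r)%R ->
    mu (ball x r `&` U) < delta%:E * mu (ball x r) ->
    ball x r `&` ~` U `<=` [set y | b%:E <= v y] ->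
    b%:E <= median mu gamma v (ball x r).
  move=> r0 Ur vb; apply: median_ge.
  apply: (@density_complement _ _ _ _ _ (ball x r `&` U)).
  - by case/andP: (mu_balls x r0).
  - move=> y xy; have [Uy|Uy] := pselect (U y); first by left.
    by right; split => //; apply: vb.
  - apply: le_trans (ltW Ur) _; apply: lee_wpmul2r; first exact: outer_measure_ge0.
    by rewrite lee_fin.
have dist_bounds (eta : R) (y : \bar R) : `|y - a%:E| <= eta%:E ->
    (a - eta)%:E <= y <= (a + eta)%:E.
  case: y => [b| |]//=; rewrite !lee_fin ler_norml => /andP[? ?].
  by apply/andP; split; lra.
split; apply: cvg_ereal_bounds => eta eta0; apply: filterS (close eta eta0) => r [r0 Ur uU];
  apply/andP; split.
- apply: lower => // y _ /=; apply: le_trans (abse_ge0 _).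
  by rewrite lee_fin; lra.
- by apply: upper => // y /uU /=; rewrite add0r.
- by apply: lower => // y /uU /= /dist_bounds/andP[].
- by apply: upper => // y /uU /= /dist_bounds/andP[].
Unshelve. all: by end_near. Qed.

End approximate_continuity.

(** * The exceptional sets *)

Section exceptional_sets.
Context (R : realType) (P : pmetricType R) (mu : {outer_measure set P -> \bar R}).
Context (mu_borel_regular : borel_regular mu) (mu_balls : balls_pos_finite mu)
  (mu_doubling : doubling mu) (X : qbfs mu).
Context (X_maximal : maximal_bounded X).
Context (s : R) (s01 : (0 < s <= 1)%R).
Context (u : P -> \bar R).

(** The neighbourhood [U] of a quasicontinuity set works at every point around
    which no ball is filled by [phi >= 1] in proportion [gamma]; such a point is
    not in [U] because [U] is open. *)
Lemma not_approx_continuous_small (gamma : R) (z : P) (rho d : R) :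
  quasicontinuous s X u -> (0 < gamma < 1)%R -> (0 < rho)%R -> (0 < d)%R ->
  small_capacity s X [set x | ball z rho x /\ ~ approx_continuous mu gamma u x] d.
Proof.
move=> uqc gamma01 rho0 d0.
have [K K0 KP] := small_capacity_density mu_borel_regular mu_balls mu_doubling
  X_maximal s01 z gamma01 rho0.
have dK0 : (0 < d / K)%R by rewrite divr_gt0.
have [N /small_capacity_of_capacity Nsmall uN] := uqc _ dK0.
have [phi [g [pg Nphi Ng [U [oU NU U1]]]]] := Nsmall.
have := KP phi g _ dK0 pg Nphi Ng; rewrite mulrCA divff ?gt_eqF// mulr1.
apply: sub_small_capacity => x [zx nac]; split => //.
apply: contrapT => nlevel; apply: nac.
have low r : (0 < r < 8^-1)%R -> mu (ball x r `&` U) < gamma%:E * mu (ball x r).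
  move=> r01; rewrite ltNge; apply/negP => lev; apply: nlevel; exists r => //.
  apply: le_trans lev _; apply: le_outer_measure => y [xy Uy]; split => //.
  exact: U1.
exists U; split; last first.
  near=> r; apply: low; apply/andP; split; near: r.
    exact: nbhs_right_gt.
  by apply: nbhs_right_lt; rewrite invr_gt0.
(* otherwise a small ball around [x] lies in [U] and violates [low] *)
have Ux : ~ U x.
  move=> Ux; have /nbhs_ballP[e /= e0 eU] : nbhs x U by exact: open_nbhs_nbhs.
  pose r := Num.min e (16^-1)%R.
  have r0 : (0 < r)%R by rewrite lt_min e0 invr_gt0 ltr0n.
  have r01 : (0 < r < 8^-1)%R.
    by rewrite r0/= gt_min; apply/orP; right; rewrite ltf_pV2 ?posrE ?ltr0n// ltr_nat.
  have := low r r01; rewrite (setIidl _); last first.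
    by move=> y xy; apply: eU; apply: le_ball xy; rewrite ge_min lexx.
  have /andP[b0 bfin] := mu_balls x r0; move: b0 bfin.
  case: (mu (ball x r)) => [b| |]//; rewrite -EFinM !lte_fin => b0 _.
  by case/andP: gamma01; nra.
move=> A uxA; have xN : (~` N) x by move=> /NU.
have : \forall y \near x, ~ N y -> A (u y) := proj1 (subspace_continuousP _ _) uN x xN A uxA.
suff : nbhs x [set y | ~ N y -> A (u y)] -> nbhs x [set y | ~ U y -> A (u y)] by [].
by apply: filterS => y uA Uy; apply: uA => /NU.
Unshelve. all: by end_near. Qed.

(** On a ball, [u] is bounded by its value at one good point of the ball and a
    multiple of the gradient. *)
Lemma dotM_local (g : P -> \bar R) (z : P) (rho : R) : (0 < rho)%R ->
  L0 mu u -> sgradients mu s u g -> qcarrier X g ->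
  qcarrier X (fun x => `|u x| * (\1_(ball z rho) x)%:E).
Proof.
move=> rho0 [mu_ ufin] [mg g0 [E E0 ug]] Xg.
have [XL0 _ XZ XD] := qbfs_subspace X; have [_ gfin] := XL0 _ Xg.
have mB := caratheodory_ball z rho mu_borel_regular.
have Xchi : qcarrier X (fun x => (\1_(ball z rho) x)%:E).
  apply: qnorm_carrier; apply: qnorm_indic => //.
  by case/andP: (mu_balls z rho0).
have [y [zy Ey uy gy]] : exists y, [/\ ball z rho y, ~ E y, u y \is a fin_num &
    g y \is a fin_num].
  apply: contrapT => nex; have [A [_ A0 uA]] := ufin; have [B [_ B0 gB]] := gfin.
  have /andP[+ _] := mu_balls z rho0; rewrite ltNge => /negP; apply.
  apply: (@le_trans _ _ (mu (E `|` (A `|` B)))).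
    apply: le_outer_measure => y zy; apply: contrapT => /not_orP[Ey /not_orP[Ay By]].
    apply: nex; exists y; split => //.
      by apply: contrapT => uy; apply: Ay; exact: uA.
    by apply: contrapT => gy; apply: By; exact: gB.
  apply: le_trans (outer_measureU2 mu _ _) _; rewrite E0 add0e.
  apply: le_trans (outer_measureU2 mu _ _) _.
  by rewrite [X in X + _](A0 : mu A = 0) (B0 : mu B = 0) adde0.
pose D := ((2 * rho) `^ s)%R.
have D0 : (0 <= D)%R by exact: powR_ge0.
pose a := (`|fine (u y)| + D * fine (g y))%R.
have a0 : (0 <= a)%R by rewrite addr_ge0// mulr_ge0// fine_ge0.
have Xh := XD _ _ (XZ a _ Xchi) (XZ D _ Xg).
apply: (proj1 (@qbfs_lattice _ _ _ X _ _ _ Xh _)).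
- apply: emeasurable_funM; first exact: measurableT_comp.
  by apply/measurable_EFinP; exact: measurable_indic.
exists E; split => //; first exact: caratheodory_null.
move=> x /= nle; apply: contrapT => Ex; apply: nle.
have Dg0 : 0 <= D%:E * g x by rewrite mule_ge0.
have [zx|zx] := pselect (ball z rho x); last first.
  by rewrite indicE memNset// !mule0 add0e abse0 abse_ge0.
rewrite indicE mem_set// !mule1 abse_id [leRHS]gee0_abs ?adde_ge0//.
have xy : (mdist x y `^ s <= D)%R.
  case/andP: s01 => s0 _; apply: ge0_ler_powR; rewrite ?nnegrE ?mdist_ge0 ?(ltW s0)//.
    by rewrite mulr_ge0// ltW.
  have := metric_triangle x z y; rewrite (metric_sym x z).
  by move/ballP: zx => zx; move/ballP: zy => zy; lra.
have := ug x y Ex Ey; rewrite -(fineK uy) -(fineK gy) => uxy.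
have {uxy} : `|u x - (fine (u y))%:E| <= D%:E * (g x + (fine (g y))%:E).
  apply: le_trans uxy _; apply: lee_wpmul2r; last by rewrite lee_fin.
  by rewrite adde_ge0// lee_fin fine_ge0.
rewrite ge0_muleDr//; last by rewrite lee_fin fine_ge0.
case: (D%:E * g x) Dg0 => [h| |]// h0; last by move=> _; rewrite addey// leey.
case: (u x) => [v| |]//.
rewrite -EFinB -EFinM -!EFinD !lee_fin /a => uxy.
by have := ler_normD (v - fine (u y))%R (fine (u y)); rewrite subrK; lra.
Qed.

Lemma sgradients_scale_abs (g : P -> \bar R) (e : R) : (0 < e)%R ->
  L0 mu u -> sgradients mu s u g ->
  sgradients mu s (fun x => e%:E * `|u x|) (fun x => e%:E * g x).
Proof.
move=> e0 [mu_ ufin] [mg g0 [E E0 ug]]; split.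
- by apply: emeasurable_funM => //; exact: measurable_cst.
- by move=> x; rewrite mule_ge0// lee_fin ltW.
exists E => // x y Ex Ey; have := ug x y Ex Ey.
rewrite -ge0_muleDr// muleCA.
have : 0 <= (mdist x y `^ s)%:E * (g x + g y).
  by rewrite mule_ge0 ?lee_fin ?powR_ge0// adde_ge0.
case: ((mdist x y `^ s)%:E * (g x + g y)) => [h| |]//; last first.
  by rewrite gt0_muley ?lte_fin// !leey.
case: (u x) => [v| |]//; case: (u y) => [w| |]//= _.
rewrite !lee_fin => vw.
rewrite -mulrBr normrM gtr0_norm//; apply: ler_wpM2l; first exact: ltW.
by apply: le_trans vw; exact: ler_dist_dist.
Qed.

(** Near such a point, and off a set of proportion less than 1/2, [|u|] exceeds
    every constant; the truncations of [e |u|] are thus equal to 1 there, and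
    their norms tend to 0 with [e]. *)
Lemma approx_infinite_small (z : P) (rho d : R) :
  dotM s X u -> (0 < rho)%R -> (0 < d)%R ->
  small_capacity s X [set x | [/\ ball z rho x, approx_continuous mu (2^-1) u x &
    u x \isn't a fin_num]] d.
Proof.
move=> [u0 /ereal_inf_lt[_ [g ug <-] Ng]] rho0 d0.
have half01 : (0 < (2^-1 : R) < 1)%R by apply/andP; split; lra.
have [K K0 KP] := small_capacity_density mu_borel_regular mu_balls mu_doubling
  X_maximal s01 z half01 rho0.
have rho10 : (0 < rho + 1)%R by rewrite addr_gt0.
have Xg := qnorm_carrier Ng.
have XV := dotM_local z rho10 u0 ug Xg.
set V := (fun x => _) in XV.
have [c c1 cP] := qnormD X; have c0 : (0 < c)%R by apply: lt_le_trans c1.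
have [n n0 gVn] : exists2 n : R, (0 <= n)%R & qnorm X (fun x => g x + V x) <= n%:E.
  have [_ _ _ XD] := qbfs_subspace X; have := XD _ _ Xg XV.
  have [+ _ _ _] := qnorm_quasinorm X => /[apply].
  by case: (qnorm X _) => [m /andP[m0 _]|/andP[]|/andP[]]//; exists m.
have dK0 : (0 < d / K)%R by rewrite divr_gt0.
(* with this scale the test function below has norm at most [d / K] *)
pose e := (d / K / (n + 1))%R.
have n10 : (0 < n + 1)%R by rewrite ltr_wpDl.
have e0 : (0 < e)%R by rewrite divr_gt0.
have en : (e * n <= d / K)%R.
  by rewrite /e mulrAC ler_pdivrMr// ler_wpM2l ?(ltW dK0)// lerDl.
have g0 : forall x, 0 <= g x by case: ug.
have [mu_ _] := u0.
have meu : cara_measurable_fun mu (fun x => e%:E * `|u x|).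
  apply: emeasurable_funM; first exact: measurable_cst.
  exact: measurableT_comp.
have [mw w01 meg eg0 wgrad] := truncation_pair meu (sgradients_scale_abs e0 u0 ug).
pose w x := clamp (e%:E * `|u x|).
have mchi : cara_measurable_fun mu (fun x => (\1_(ball z (rho + 1)) x)%:E).
  by apply/measurable_EFinP; apply: measurable_indic; exact: caratheodory_ball.
have megchi : cara_measurable_fun mu (fun x => e%:E * g x * (\1_(ball z (rho + 1)) x)%:E).
  exact: emeasurable_funM.
have pair := cutoff_pair (z := z) (rho := rho) mu_borel_regular s01 mw w01 megchi eg0 wgrad.
have [mpsi psi01 mG G0 _] := pair.
have wV x : (w x)%:E * (\1_(ball z (rho + 1)) x)%:E <= e%:E * V x.
  rewrite /V muleA; apply: lee_wpmul2r; first by rewrite lee_fin.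
  apply: le_trans (clamp_le _) _; rewrite gee0_abs// mule_ge0//.
  by rewrite lee_fin ltW.
have V0 x : 0 <= V x by rewrite mule_ge0// lee_fin.
have small f : cara_measurable_fun mu f -> (forall x, 0 <= f x) ->
    (forall x, f x <= e%:E * (g x + V x)) -> qnorm X f <= (d / K)%:E.
  move=> mf f0 fgV; apply: (@le_trans _ _ (qnorm X (fun x => e%:E * (g x + V x)))).
    by apply: le_qnorm => // x; rewrite !gee0_abs// mule_ge0 ?adde_ge0// lee_fin ltW.
  apply: le_trans (qnormZ _ _ e0) _; apply: (@le_trans _ _ (e * n)%:E).
    by rewrite (EFinM e n); apply: lee_wpmul2l => //; rewrite lee_fin ltW.
  by rewrite lee_fin.
have := KP _ _ _ dK0 pair _ _; rewrite mulrCA divff ?gt_eqF// mulr1 => KP'.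
apply: sub_small_capacity (KP' _ _); last 2 first.
- apply: small => // [x|x]; first by rewrite lee_fin; case/andP: (psi01 x).
  apply: (@le_trans _ _ ((w x)%:E * (\1_(ball z (rho + 1)) x)%:E)); last first.
    by apply: le_trans (wV x) _; apply: lee_wpmul2l; rewrite ?lee_fin ?(ltW e0)// leeDr.
  have w0 : (0 <= w x)%R by case/andP: (w01 x).
  have [zx|/cutoff_out ->] := pselect (ball z (rho + 1) x); last first.
    by rewrite mul0r mule_ge0.
  rewrite indicE mem_set// mule1 lee_fin ler_piMl//.
  by case/andP: (cutoff01 z rho x).
- apply: small => // x; rewrite ge0_muleDr// ge0_muleDl//; last first.
    by rewrite lee_fin; case/andP: (w01 x).
  apply: leeD; last exact: wV.
  by rewrite -[leRHS]mule1; apply: lee_wpmul2l => //; rewrite lee_fin indicE lern1 leq_b1.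
move=> x [zx [U [ux Ud]] uxinf]; split => //.
have big : nbhs (u x) [set y : \bar R | (e^-1)%:E <= `|y|].
  case: (u x) uxinf => [a| |]// _.
  - exists e^-1%R; split; first exact: num_real.
    by move=> y ey /=; apply: le_trans (ltW ey) (lee_abs _).
  - exists (- e^-1)%R; split; first exact: num_real.
    by move=> y ey /=; rewrite -abseN; apply: le_trans (lee_abs _); rewrite leeNr ltW.
have near0 : \forall r \near 0^'+, [/\ (0 < r < 8^-1)%R,
    mu (ball x r `&` U) < (2^-1)%:E * mu (ball x r),
    ball x r `<=` ball z rho &
    ball x r `&` ~` U `<=` [set y | (e^-1)%:E <= `|u y|]].
  have /nbhs_ballP[b /= b0 bz] : nbhs x (ball z rho).
    by apply: open_nbhs_nbhs; split => //; exact: open_metric_ball.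
  near=> r; split; last by near: r; exact: (within_near_ball (ux _ big)).
  - by apply/andP; split; near: r; [exact: nbhs_right_gt|
      apply: nbhs_right_lt; rewrite invr_gt0].
  - by near: r; exact: Ud.
  - apply: subset_trans bz; apply: le_ball; near: r; exact: nbhs_right_le.
have [r [r01 lowU rz rU]] := filter_ex near0; exists r => //.
have r0 : (0 < r)%R by case/andP: r01.
apply: (@density_complement _ _ _ _ _ (ball x r `&` U)).
- by case/andP: (mu_balls x r0).
- move=> y xy; have [Uy|Uy] := pselect (U y); [by left|right; split => //=].
  rewrite cutoff_in ?mul1r; last exact: rz.
  apply: clamp_ge1; apply: (@le_trans _ _ (e%:E * (e^-1)%:E)).
    by rewrite -EFinM divff// gt_eqF.
  by apply: lee_wpmul2l; [rewrite lee_fin ltW|exact: rU].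
- rewrite (_ : 1 - 2^-1 = 2^-1 :> R)%R; last by field.
  exact: ltW.
Unshelve. all: by end_near. Qed.

End exceptional_sets.

(** * Generalized Lebesgue points *)

Theorem theorem1p1 (R : realType) (P : pmetricType R)
    (mu : {outer_measure set P -> \bar R})
    (mu_borel_regular : borel_regular mu)
    (mu_balls : balls_pos_finite mu)
    (mu_doubling : doubling mu)
    (X : qbfs mu)
    (X_abs_continuous : abs_continuous X)
    (X_maximal : forall gamma : R, (0 < gamma < 1)%R ->
       forall (z : P) (r : R), (0 < r)%R ->
       exists C : R, forall g : P -> \bar R, qcarrier X g ->
         qnorm X (fun x => median_maximal mu gamma 1 g x * (\1_(ball z r) x)%:E)
           <= C%:E * qnorm X g)
    (s : R) (s_range : (0 < s <= 1)%R)
    (u : P -> \bar R) (u_dotM : dotM s X u)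
    (u_quasicontinuous : quasicontinuous s X u) :
  exists2 E : set P, capacity s X E = 0 &
    forall x : P, ~ E x -> forall gamma : R, (0 < gamma < 1)%R ->
      median mu gamma (fun y => `|u y - u x|) (ball x r) @[r --> 0^'+] --> 0 /\
      median mu gamma u (ball x r) @[r --> 0^'+] --> u x.
Proof.
pose z0 : P := point.
(* index 0 collects the infinite values, index [m.+1] the failures of
   approximate continuity for the proportion 1 / (m + 2) *)
pose W (n k : nat) : set P := if n is m.+1 then
  [set x | ball z0 k.+1%:R x /\ ~ approx_continuous mu (m.+2%:R^-1) u x]
  else [set x | [/\ ball z0 k.+1%:R x, approx_continuous mu (2^-1) u x &
    u x \isn't a fin_num]].
have Wsmall n k (d : R) : (0 < d)%R -> small_capacity s X (W n k) d.
  case: n => [|m] d0; first exact: approx_infinite_small.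
  apply: not_approx_continuous_small => //.
  by rewrite invr_gt0 ltr0n/= invf_lt1 ?ltr0n// ltr1n.
exists (\bigcup_n \bigcup_k W n k).
  apply: capacity_of_small_capacity => d d0.
  apply: small_capacity_bigcup d0 => n e e0; apply: small_capacity_bigcup e0 => k.
  exact: Wsmall.
move=> x Ex gamma gamma01.
have [k zx] : exists k : nat, ball z0 k.+1%:R x.
  exists (Num.bound (mdist z0 x)); apply/ballP.
  by apply: lt_trans (archi_boundP (mdist_ge0 _ _)) _; rewrite ltr_nat.
have ac m : approx_continuous mu (m.+2%:R^-1) u x.
  by apply: contrapT => nac; apply: Ex; exists m.+1 => //; exists k.
have ufin : u x \is a fin_num.
  by apply: contrapT => /negP ufin; apply: Ex; exists 0%N => //; exists k.
pose b := Num.min gamma (1 - gamma)%R.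
have b0 : (0 < b)%R by rewrite lt_min; case/andP: gamma01 => ? ?; apply/andP; split; lra.
have mb : ((Num.bound b^-1).+2%:R^-1 <= b)%R.
  rewrite -[leRHS]invrK lef_pV2 ?posrE ?invr_gt0//; apply: ltW.
  by apply: lt_trans (archi_boundP _) _; rewrite ?ltr_nat// invr_ge0 ltW.
apply: (median_limits mu_balls gamma01 _ _ ufin (ac (Num.bound b^-1))).
  by apply: le_trans mb _; rewrite ge_min lexx.
by apply: le_trans mb _; rewrite ge_min lexx orbT.
Qed.
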